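(* The category $\Delta\circlearrowright\Omega_p$, with direct and inverse wide subcategories $(\Delta\circlearrowright\Omega_p)^+$ and $(\Delta\circlearrowright\Omega_p)^-$ and degree function $d[n\circlearrowright S]=n+|gen(n,S)|$, is a (strict) Reedy category.
   Context: **Trees.** A planar rooted tree $S$ is a finite rooted tree with edge set $E(S)$, vertex set $V(S)$, root edge $\mathbf r=\mathbf r_S$, and a linear order on the inputs of each vertex; vertices may have no inputs; a leaf is an edge which is not the output of any vertex; the tree with one edge and no vertices is allowed. Planar trees are taken up to planar isomorphism (one representative per class). $\Omega_p(S)$ is the free nonsymmetric colored operad on $S$: its colors are the edges of $S$, and it is freely generated by one operation for each vertex, from the ordered list of inputs to the output. $\varnothing$ denotes the empty tree, with $\Omega_p(\varnothing)$ the operad with no colors. **Actions.** An action of a small category $\mathcal C$ (objects $C_0$, morphisms $C_1$, source $s$, target $t$) on a set $A$ consists of $\mu:A\to C_0$ (moment) and $\bullet:\{(f,a)\in C_1\times A:s(f)=\mu(a)\}\to A$ with $\mu(f\bullet a)=t(f)$, $(f\circ f')\bullet a=f\bullet(f'\bullet a)$, $\mathrm{id}_{\mu(a)}\bullet a=a$. For a nonsymmetric colored operad $\mathcal O$ let $\mathrm{Mor}(\mathcal O)$ be its set of operations; each operation $g$ has a source $s(g)$ (ordered list of colors) and target $t(g)$ (a color). A *rooted action* of $\mathcal C$ on $\mathcal O$ is an action of $\mathcal C$ on $\mathrm{Mor}(\mathcal O)$ with $\mu(\gamma(g;g_1,\dots,g_k))=\mu(g)$ for operadic compositions $\gamma$,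 and $s(f\bullet g)=s(g)$ as ordered lists. For a color $c$ put $\mu(c):=\mu(\mathrm{id}_c)$; then $\mu(g)=\mu(t(g))$. $\mathcal{RA}^{\mathcal Op}_{ns}$ is the category of rooted actions on nonsymmetric operads; a morphism $X$ is a functor $X^c$ between acting categories and an operad map $X^d$ with $X^c\mu=\mu X^d$ and $X^d(a\bullet f)=X^c(a)\bullet X^d(f)$. **Objects $[n\circlearrowright S]$** ($n\ge0$, $S$ a planar rooted tree). $[n]$ is the poset $0\le\dots\le n$ as a category. $\mathcal C_{n,S}$ is the disjoint union of $[n]$ and the discrete category on objects $*_e$, $e\in E(S)\setminus\{\mathbf r\}$; $p_{i,j}:i\to j$ is the unique map in $[n]$. $\mathcal O_{0,S}=\Omega_p(S)$ with $\mu(e)=*_e$ for $e\ne\mathbf r$, $\mu(\mathbf r)=0$. $\mathcal O_{n,S}$ is obtained from $\mathcal O_{n-1,S}$ by freely adjoining, for each operation $h$ of $\mathcal O_{n-1,S}$ (identities and composites included) with $\mu(h)=n-1$, a new color $(n,h)$ (distinct for distinct $h$) and a new generating operation $p_{n-1,n}\bullet h$ with source $s(h)$, target $(n,h)$ and moment $n$. The action is $p_{\ell,\ell'}\bullet h=p_{\ell'-1,\ell'}\bullet(\cdots\bullet(p_{\ell,\ell+1}\bullet h))$, identities acting trivially. This rooted action of $\mathcal C_{n,S}$ on $\mathcal O_{n,S}$ is $[n\circlearrowright S]$; $[n\circlearrowright\varnothing]$ is $[n]$ acting on the empty operad ($\mathcal C_{n,\varnothing}=[n]$, $\mathcal O_{n,\varnothing}$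 has no colors). $\Delta\circlearrowright\Omega_p$ is the full subcategory of $\mathcal{RA}^{\mathcal Op}_{ns}$ on all $[n\circlearrowright S]$ and $[n\circlearrowright\varnothing]$, $n\ge0$. **Degree.** $gen(n,S)$ is the set of generating operations of $\mathcal O_{n,S}$: the vertices of $S$ together with the adjoined operations $p_{i-1,i}\bullet h$ with $\mu(h)=i-1$, $1\le i\le n$. The degree is $d[n\circlearrowright S]=n+|gen(n,S)|=n+|\mathrm{Col}(\mathcal O_{n,S})|+|V(S)|-|E(S)|$, where $\mathrm{Col}$ denotes the set of colors. **Maps.** A map $X:[n\circlearrowright S]\to[m\circlearrowright R]$ is determined by $\alpha=X^c|_{[n]}:[n]\to\mathcal C_{m,R}$ and $\beta=X^d|_{\mathcal O_{0,S}}:\Omega_p(S)\to\mathcal O_{m,R}$; write $X=(\alpha,\beta)$, $\hat\alpha=X^c$, $\hat\beta=X^d$. **Subcategories.** $(\Delta\circlearrowright\Omega_p)^+$: maps with $\alpha:[n]\to\mathcal C_{m,R}$ injective on objects and $\beta:\Omega_p(S)\to\mathcal O_{m,R}$ injective on colors. $(\Delta\circlearrowright\Omega_p)^-$: maps such that every object of $[m]\subseteq\mathcal C_{m,R}$ is in the image of $\alpha$, $\hat\beta:\mathcal O_{n,S}\to\mathcal O_{m,R}$ is surjective on colors, and $\beta$ takes leaves of $S$ to leaves of $R$. **Reedy category.** A small category $\mathcal R$ with wide subcategories (containing all objects) $\mathcal R^+,\mathcal R^-$ and a function $d:\mathrm{Ob}\,\mathcal R\to\mathbb N$ such that every non-identity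 morphism of $\mathcal R^+$ raises degree, every non-identity morphism of $\mathcal R^-$ lowers degree, and every morphism of $\mathcal R$ factors uniquely as a morphism of $\mathcal R^-$ followed by a morphism of $\mathcal R^+$.
   Formalization: As d is 0 on both [0↻∅] and [0↻η] (η: one edge, no vertices), the direct map between them does not raise d; the Reedy claim is proved for d+1 (0 on [0↻∅]), and for d itself direct maps raise and inverse maps lower degree, with only that map excepted. *)

(* Defs.v *)
From HB Require Import structures.
From mathcomp Require Import all_boot.
From mathcomp Require Import boolp.

Set Implicit Arguments.
Unset Strict Implicit.
Unset Printing Implicit Defensive.

Record category := Category {
  Ob : Type;
  Hom : Ob -> Ob -> Type;
  idc : forall x, Hom x x;
  compc : forall x y z, Hom y z -> Hom x y -> Hom x z;
  compc1 : forall x y (f : Hom x y), compc f (idc x) = f;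
  comp1c : forall x y (f : Hom x y), compc (idc y) f = f;
  compcA : forall x y z w (h : Hom z w) (g : Hom y z) (f : Hom x y),
    compc h (compc g f) = compc (compc h g) f
}.
Arguments compc {c x y z}.

Record functor (C D : category) := Functor {
  fob :> Ob C -> Ob D;
  fhom : forall x y, Hom x y -> Hom (fob x) (fob y);
  fhom_id : forall x, fhom (idc x) = idc (fob x);
  fhom_comp : forall x y z (g : Hom y z) (f : Hom x y),
    fhom (compc g f) = compc (fhom g) (fhom f)
}.

(* Nonsymmetric colored operads.  The composition [gamma g gs _] is defined    *)
(* exactly when the list of targets of [gs] is the source of [g].  In          *)
(* [gammaA] the list [ps] consists of the composable pairs (g_i; hs_i).        *)
Record operad := Operad {
  Col : Type;
  Mor : Type;
  src : Mor -> seq Col;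
  tgt : Mor -> Col;
  idm : Col -> Mor;
  gamma : forall (g : Mor) (gs : seq Mor), map tgt gs = src g -> Mor;
  src_idm : forall c, src (idm c) = [:: c];
  tgt_idm : forall c, tgt (idm c) = c;
  src_gamma : forall g gs (e : map tgt gs = src g),
    src (gamma e) = flatten (map src gs);
  tgt_gamma : forall g gs (e : map tgt gs = src g), tgt (gamma e) = tgt g;
  gamma1l : forall g (e : map tgt [:: g] = src (idm (tgt g))), gamma e = g;
  gamma1r : forall g (e : map tgt (map idm (src g)) = src g), gamma e = g;
  gammaA : forall g (ps : seq {p : Mor * seq Mor | map tgt p.2 = src p.1})
      (e1 : map tgt [seq (sval p).1 | p <- ps] = src g)
      (e2 : map tgt (flatten [seq (sval p).2 | p <- ps]) = src (gamma e1))
      (e3 : map tgt [seq gamma (svalP p) | p <- ps] = src g),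
    gamma e2 = gamma e3
}.
Arguments src {o}.
Arguments tgt {o}.
Arguments idm {o}.
Arguments gamma {o} g gs.

Record operad_map (P Q : operad) := OperadMap {
  fcol : Col P -> Col Q;
  fmor :> Mor P -> Mor Q;
  fmor_src : forall g, src (fmor g) = map fcol (src g);
  fmor_tgt : forall g, tgt (fmor g) = fcol (tgt g);
  fmor_idm : forall c, fmor (idm c) = idm (fcol c);
  fmor_gamma : forall g gs (e : map tgt gs = src g)
      (e' : map tgt (map fmor gs) = src (fmor g)),
    fmor (gamma g gs e) = gamma (fmor g) (map fmor gs) e'
}.

(* [act f g _] is f • g, defined exactly when the source of f is [mu g].       *)
Record rooted_action := RootedAction {
  acat : category;
  aop : operad;
  mu : Mor aop -> Ob acat;
  act : forall (x y : Ob acat) (f : Hom x y) (g : Mor aop), mu g = x -> Mor aop;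
  mu_act : forall x y (f : Hom x y) g (e : mu g = x), mu (act f e) = y;
  act_comp : forall x y z (f : Hom y z) (f' : Hom x y) g (e : mu g = x),
    act (compc f f') e = act f (mu_act f' e);
  act_id : forall x g (e : mu g = x), act (idc x) e = g;
  mu_gamma : forall g gs (e : map tgt gs = src g), mu (gamma g gs e) = mu g;
  src_act : forall x y (f : Hom x y) g (e : mu g = x), src (act f e) = src g
}.
Arguments mu {r}.
Arguments act {r x y} f g.

Record ra_map (X Y : rooted_action) := RAMap {
  mapc : functor (acat X) (acat Y);
  mapd : operad_map (aop X) (aop Y);
  mapc_mu : forall g, mapc (mu g) = mu (mapd g);
  mapd_act : forall x y (f : Hom x y) g (e : mu g = x)
      (e' : mu (mapd g) = mapc x),
    mapd (act f g e) = act (fhom mapc f) (mapd g) e'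
}.

Section RACategory.

Lemma functor_eq (C D : category)
  (Fo : Ob C -> Ob D) (Fh Gh : forall x y, Hom x y -> Hom (Fo x) (Fo y)) p q p' q' :
  Fh = Gh -> @Functor C D Fo Fh p q = @Functor C D Fo Gh p' q'.
Proof.
by move=> eFG; subst Gh; congr Functor; apply: Prop_irrelevance.
Qed.

Lemma operad_map_eq (P Q : operad) (F G : operad_map P Q) :
  fcol F = fcol G -> fmor F = fmor G -> F = G.
Proof.
case: F G => [c m ? ? ? ?] [c' m' ? ? ? ?] /= ec em; subst c' m'.
by congr OperadMap; apply: Prop_irrelevance.
Qed.

Lemma ra_map_eq (X Y : rooted_action) (F G : ra_map X Y) :
  mapc F = mapc G -> mapd F = mapd G -> F = G.
Proof.
case: F G => [c m ? ?] [c' m' ? ?] /= ec em; subst c' m'.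
by congr RAMap; apply: Prop_irrelevance.
Qed.

Definition functor_id (C : category) : functor C C :=
  @Functor C C id (fun x y f => f) (fun=> erefl) (fun _ _ _ _ _ => erefl).

Definition functor_comp (C D E : category) (G : functor D E) (F : functor C D) :
  functor C E.
Proof.
refine (@Functor C E (G \o F) (fun x y f => fhom G (fhom F f)) _ _).
- by move=> x; rewrite !fhom_id.
- by move=> x y z g f; rewrite !fhom_comp.
Defined.

Definition operad_map_id (P : operad) : operad_map P P.
Proof.
refine (@OperadMap P P id id _ _ _ _) => //.
- by move=> g; rewrite map_id.
- move=> g gs e; rewrite map_id => e'; congr gamma; exact: Prop_irrelevance.
Defined.

Lemma operad_map_tgts (P Q : operad) (F : operad_map P Q) g gs :
  map tgt gs = src g -> map tgt (map F gs) = src (F g).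
Proof.
move=> e; rewrite fmor_src -e -!map_comp; apply: eq_map => x /=.
exact: fmor_tgt.
Qed.

Definition operad_map_comp (P Q R : operad) (G : operad_map Q R)
  (F : operad_map P Q) : operad_map P R.
Proof.
refine (@OperadMap P R (fcol G \o fcol F) (G \o F) _ _ _ _).
- by move=> g /=; rewrite !fmor_src map_comp.
- by move=> g /=; rewrite !fmor_tgt.
- by move=> c /=; rewrite !fmor_idm.
- move=> g gs e; rewrite map_comp => e' /=.
  have e1 := operad_map_tgts F e.
  exact: (etrans (congr1 G (fmor_gamma e e1)) (fmor_gamma e1 e')).
Defined.

Definition ra_id (X : rooted_action) : ra_map X X.
Proof.
refine (@RAMap X X (functor_id _) (operad_map_id _) _ _) => //=.
by move=> x y f g e e'; congr act; exact: Prop_irrelevance.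
Defined.

Definition ra_comp (X Y Z : rooted_action) (G : ra_map Y Z) (F : ra_map X Y) :
  ra_map X Z.
Proof.
refine (@RAMap X Z (functor_comp (mapc G) (mapc F))
                   (operad_map_comp (mapd G) (mapd F)) _ _) => /=.
- by move=> g; rewrite !mapc_mu.
- move=> x y f g e e'.
  have e1 : mu (mapd F g) = mapc F x by rewrite -mapc_mu e.
  by rewrite (mapd_act f e e1) (mapd_act (fhom (mapc F) f) e1 e').
Defined.

Lemma ra_comp1 X Y (F : ra_map X Y) : ra_comp F (ra_id X) = F.
Proof.
apply: ra_map_eq => /=; last exact: operad_map_eq.
by case: (mapc F) => *; exact: functor_eq.
Qed.

Lemma ra_1comp X Y (F : ra_map X Y) : ra_comp (ra_id Y) F = F.
Proof.
apply: ra_map_eq => /=; last exact: operad_map_eq.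
by case: (mapc F) => *; exact: functor_eq.
Qed.

Lemma ra_compA X Y Z W (H : ra_map Z W) (G : ra_map Y Z) (F : ra_map X Y) :
  ra_comp H (ra_comp G F) = ra_comp (ra_comp H G) F.
Proof.
apply: ra_map_eq => /=; last exact: operad_map_eq.
by apply: functor_eq.
Qed.

End RACategory.

(* [PVertex ts] is the tree whose root edge is the output of a vertex with     *)
(* list of input edges the root edges of [ts].  Equality of [ptree] is planar  *)
(* isomorphism, so there is one representative per isomorphism class.          *)
Inductive ptree := PLeaf | PVertex of seq ptree.

(* An edge is addressed by the path leading to it from the root edge: [::] is  *)
(* the root edge and [rcons a i] is the i-th input of the vertex with output   *)
(* [a].  A vertex is addressed by its output edge.                             *)
Fixpoint subtree (S : ptree) (a : seq nat) : option ptree :=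
  match a, S with
  | [::], _ => Some S
  | _ :: _, PLeaf => None
  | i :: a', PVertex ts => obind (fun T => subtree T a') (onth ts i)
  end.

(* [None] stands for the empty tree. *)
Definition otree := option ptree.

Section Trees.
Variable S : otree.

Definition subtree_at (a : seq nat) : option ptree := obind (subtree^~ a) S.
Definition is_edge (a : seq nat) : bool := isSome (subtree_at a).
Definition is_leaf (a : seq nat) : bool :=
  if subtree_at a is Some PLeaf then true else false.
Definition is_vertex (a : seq nat) : bool :=
  if subtree_at a is Some (PVertex _) then true else false.
Definition arity (a : seq nat) : nat :=
  if subtree_at a is Some (PVertex ts) then size ts else 0.

End Trees.

(* Raw syntax for the colors, operations and generating operations of all the  *)
(* operads O_{n,S}; [New k h] is the color (k+1, h) and [Adj k h] is the       *)
(* generating operation p_{k,k+1} • h, both adjoined at stage k+1.  Operations *)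
(* of the free operad are trees of generating operations: [Id c] is the        *)
(* identity of [c], and [Node g ts] is gamma(g; ts).                           *)
Inductive rcol : Type :=
  | Edge of seq nat
  | New of nat & rop
with rop : Type :=
  | Id of rcol
  | Node of rgen & seq rop
with rgen : Type :=
  | Vert of seq nat
  | Adj of nat & rop.

Section RawInd.
Variables (Pc : rcol -> Prop) (Po : rop -> Prop) (Pg : rgen -> Prop).
Hypothesis Pedge : forall a, Pc (Edge a).
Hypothesis Pnew : forall k h, Po h -> Pc (New k h).
Hypothesis Pid : forall c, Pc c -> Po (Id c).
Hypothesis Pnode : forall g ts, Pg g -> foldr (fun t => and (Po t)) True ts ->
  Po (Node g ts).
Hypothesis Pvert : forall a, Pg (Vert a).
Hypothesis Padj : forall k h, Po h -> Pg (Adj k h).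

Fixpoint rcol_ind' c : Pc c :=
  match c with
  | Edge a => Pedge a
  | New k h => Pnew k (rop_ind' h)
  end
with rop_ind' t : Po t :=
  match t with
  | Id c => Pid (rcol_ind' c)
  | Node g ts => Pnode (rgen_ind' g)
      ((fix all_ind ts : foldr (fun t => and (Po t)) True ts :=
          match ts with
          | [::] => I
          | t :: ts' => conj (rop_ind' t) (all_ind ts')
          end) ts)
  end
with rgen_ind' g : Pg g :=
  match g with
  | Vert a => Pvert a
  | Adj k h => Padj k (rop_ind' h)
  end.

Lemma raw_ind : [/\ forall c, Pc c, forall t, Po t & forall g, Pg g].
Proof. by split; [exact: rcol_ind' | exact: rop_ind' | exact: rgen_ind']. Qed.

End RawInd.

Section RawCount.
Notation tree := (GenTree.tree (seq nat)).

Fixpoint enc_col (c : rcol) : tree :=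
  match c with
  | Edge a => GenTree.Leaf a
  | New k h => GenTree.Node k [:: enc_op h]
  end
with enc_op (t : rop) : tree :=
  match t with
  | Id c => GenTree.Node 0 [:: enc_col c]
  | Node g ts => GenTree.Node 1 (enc_gen g :: map enc_op ts)
  end
with enc_gen (g : rgen) : tree :=
  match g with
  | Vert a => GenTree.Leaf a
  | Adj k h => GenTree.Node k [:: enc_op h]
  end.

Fixpoint dec_col (t : tree) : option rcol :=
  match t with
  | GenTree.Leaf a => Some (Edge a)
  | GenTree.Node k [:: u] => omap (New k) (dec_op u)
  | _ => None
  end
with dec_op (t : tree) : option rop :=
  match t with
  | GenTree.Node 0 [:: u] => omap Id (dec_col u)
  | GenTree.Node 1 (u :: us) =>
      omap (fun g => Node g (pmap dec_op us)) (dec_gen u)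
  | _ => None
  end
with dec_gen (t : tree) : option rgen :=
  match t with
  | GenTree.Leaf a => Some (Vert a)
  | GenTree.Node k [:: u] => omap (Adj k) (dec_op u)
  | _ => None
  end.

Lemma enc_rawK :
  [/\ pcancel enc_col dec_col, pcancel enc_op dec_op & pcancel enc_gen dec_gen].
Proof.
apply: (@raw_ind (fun c => dec_col (enc_col c) = Some c)
  (fun t => dec_op (enc_op t) = Some t) (fun g => dec_gen (enc_gen g) = Some g))
  => //=; [by move=> k h -> | by move=> c -> | | by move=> k h ->].
by move=> g ts -> ets; congr (Some (Node _ _)); elim: ts ets => //= t ts IH [-> /IH] /= ->.
Qed.

End RawCount.

HB.instance Definition _ := Countable.copy rcol
  (pcan_type (let: And3 h _ _ := enc_rawK in h)).
HB.instance Definition _ := Countable.copy rop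
  (pcan_type (let: And3 _ h _ := enc_rawK in h)).
HB.instance Definition _ := Countable.copy rgen
  (pcan_type (let: And3 _ _ h := enc_rawK in h)).

Lemma rop_ind_in (P : rop -> Prop) :
  (forall c, P (Id c)) ->
  (forall g ts, {in ts, forall t, P t} -> P (Node g ts)) ->
  forall t, P t.
Proof.
move=> Pid Pnode.
apply: (@rop_ind' (fun=> True) P (fun=> True)) => // g ts _ Pts; apply: Pnode.
elim: ts Pts => //= t ts IH [Pt /IH Pts] u.
by rewrite inE => /predU1P[->|/Pts].
Qed.

Fixpoint rsrc (t : rop) : seq rcol :=
  match t with
  | Id c => [:: c]
  | Node g ts => flatten (map rsrc ts)
  end.

Definition rgen_tgt (g : rgen) : rcol :=
  match g with
  | Vert a => Edge a
  | Adj k h => New k h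
  end.

Definition rtgt (t : rop) : rcol :=
  match t with
  | Id c => c
  | Node g ts => rgen_tgt g
  end.

(* [graft t us] grafts the operations [us], in order, onto the inputs of [t].  *)
Fixpoint graft (t : rop) (us : seq rop) : rop :=
  match t with
  | Id c => head (Id c) us
  | Node g ts => Node g
      ((fix grafts (ts : seq rop) (us : seq rop) : seq rop :=
          if ts is t :: ts' then
            graft t (take (size (rsrc t)) us)
            :: grafts ts' (drop (size (rsrc t)) us)
          else [::]) ts us)
  end.

Fixpoint grafts (ts : seq rop) (us : seq rop) : seq rop :=
  if ts is t :: ts' then
    graft t (take (size (rsrc t)) us) :: grafts ts' (drop (size (rsrc t)) us)
  else [::].

Lemma graft_node g ts us : graft (Node g ts) us = Node g (grafts ts us).
Proof. by []. Qed.

(* Raw objects: [inl i] is the object i of [n], [inr a] is *_a. *)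
Definition robj := (nat + seq nat)%type.

Definition rcol_mu (c : rcol) : robj :=
  match c with
  | Edge [::] => inl 0
  | Edge a => inr a
  | New k h => inl k.+1
  end.

Definition rmu (t : rop) : robj := rcol_mu (rtgt t).

Section Raw.
Variable S : otree.

Definition rgen_src (g : rgen) : seq rcol :=
  match g with
  | Vert a => [seq Edge (rcons a i) | i <- iota 0 (arity S a)]
  | Adj k h => rsrc h
  end.

(* Colors, operations and generating operations of O_{n,S}: the ones adjoined  *)
(* at stage k+1 (for k < n) are those for the operations h of O_{k,S} with     *)
(* moment k.                                                                   *)
Fixpoint is_col (n : nat) (c : rcol) : bool :=
  match c with
  | Edge a => is_edge S a
  | New k h => [&& k < n, is_op k h & rmu h == inl k]
  end
with is_op (n : nat) (t : rop) : bool :=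
  match t with
  | Id c => is_col n c
  | Node g ts => [&& is_gen n g, all (is_op n) ts & map rtgt ts == rgen_src g]
  end
with is_gen (n : nat) (g : rgen) : bool :=
  match g with
  | Vert a => is_vertex S a
  | Adj k h => [&& k < n, is_op k h & rmu h == inl k]
  end.

End Raw.

Section RawTheory.
Variable S : otree.

Definition level (x : robj) : nat := if x is inl k then k else 0.

Lemma is_col_mono n n' c : n <= n' -> is_col S n c -> is_col S n' c.
Proof.
by case: c => //= k h len /and3P[ltk -> ->]; rewrite (leq_trans ltk len).
Qed.

Lemma is_gen_mono n n' g : n <= n' -> is_gen S n g -> is_gen S n' g.
Proof.
by case: g => //= k h len /and3P[ltk -> ->]; rewrite (leq_trans ltk len).
Qed.

Lemma is_op_mono n n' t : n <= n' -> is_op S n t -> is_op S n' t.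
Proof.
move=> len; elim/rop_ind_in: t => /= [c|g ts IH]; first exact: is_col_mono.
case/and3P=> /(is_gen_mono len) -> /allP ots -> /=; rewrite andbT.
by apply/allP => t tts; apply: IH => //; apply: ots.
Qed.

Lemma is_gen_tgt n g : is_gen S n g -> is_col S n (rgen_tgt g).
Proof.
case: g => //= a; rewrite /is_vertex /is_edge.
by case: (subtree_at S a) => [[]|].
Qed.

Lemma is_op_tgt n t : is_op S n t -> is_col S n (rtgt t).
Proof. by case: t => //= g ts /and3P[/is_gen_tgt]. Qed.

Lemma is_op_src n t : is_op S n t -> all (is_col S n) (rsrc t).
Proof.
elim/rop_ind_in: t => /= [c ->//|g ts IH /and3P[_ /allP ots _]].
apply/allP => c /flatten_mapP[t tts]; apply: (allP (IH t tts _)).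
exact: ots.
Qed.

Lemma level_col n c : is_col S n c -> level (rcol_mu c) <= n.
Proof. by case: c => [[]|k h] //= /and3P[]. Qed.

Lemma is_col_level n c : is_col S n c -> is_col S (level (rcol_mu c)) c.
Proof. by case: c => [[]|k h] //= /and3P[_ -> ->]; rewrite ltnSn. Qed.

(* An operation with moment k is already an operation of O_{k,S}. *)
Lemma is_op_level n t : is_op S n t -> is_op S (level (rmu t)) t.
Proof.
elim/rop_ind_in: t => /= [c|g ts IH]; first exact: is_col_level.
case/and3P=> gg /allP ots /eqP ets; rewrite /rmu /= ets eqxx andbT.
have lev t : t \in ts -> level (rcol_mu (rtgt t)) <= level (rcol_mu (rgen_tgt g)).
  move=> tts; have: rtgt t \in rgen_src S g by rewrite -ets map_f.
  case: g {IH} gg ets => [a|k h] /= gg ets.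
    by case/mapP=> i _ ->; case: a {gg ets}.
  case/and3P: gg => _ oh _ /(allP (is_op_src oh)) /level_col le_k.
  exact: leqW.
apply/andP; split.
  case: g gg {lev ets IH} => //= k h /and3P[_ -> ->]; by rewrite ltnSn.
apply/allP => t tts; apply: (is_op_mono (lev t tts)).
by apply: IH => //; apply: ots.
Qed.

Lemma rtgt_graft t us : map rtgt us = rsrc t -> rtgt (graft t us) = rtgt t.
Proof. by case: t us => [c|g ts] //= [|u us] //= []. Qed.

Lemma rsrc_graft t us : size us = size (rsrc t) ->
  rsrc (graft t us) = flatten (map rsrc us).
Proof.
elim/rop_ind_in: t us => [c|g ts IH] us.
  by case: us => [|u [|]] //= _; rewrite cats0.
rewrite graft_node /= => sus.
elim: ts us IH sus => [|t ts IHts] us IH /=; first by move/size0nil->.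
rewrite size_cat => sus.
have les : size (rsrc t) <= size us by rewrite sus leq_addr.
rewrite IH ?mem_head ?size_takel // IHts.
- by rewrite -flatten_cat -map_cat cat_take_drop.
- by move=> u uts us' /=; apply: IH; rewrite inE uts orbT.
- by rewrite size_drop sus addKn.
Qed.

Lemma map_rtgt_grafts ts us : map rtgt us = flatten (map rsrc ts) ->
  map rtgt (grafts ts us) = map rtgt ts.
Proof.
elim: ts us => //= t ts IH us eus.
rewrite rtgt_graft; last by rewrite map_take eus take_size_cat.
by congr (_ :: _); apply: IH; rewrite map_drop eus drop_size_cat.
Qed.

Lemma is_op_graft n t us : is_op S n t -> all (is_op S n) us ->
  map rtgt us = rsrc t -> is_op S n (graft t us).
Proof.
elim/rop_ind_in: t us => [c|g ts IH] us.
  by case: us => [|u us] //= _ /andP[].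
rewrite graft_node /= => /and3P[-> ots /eqP <-] ous eus.
rewrite map_rtgt_grafts // eqxx andbT /=.
elim: ts us ots IH ous eus => [|t ts IHts] us //= /andP[ot ots] IH ous eus.
have sz : size us = size (rsrc t) + size (flatten (map rsrc ts)).
  by rewrite -(size_map rtgt) eus size_cat.
apply/andP; split.
  apply: IH => //; first exact: mem_head.
    by apply/allP => u /mem_take; apply: (allP ous).
  by rewrite map_take eus take_size_cat.
apply: IHts => //.
- by move=> u uts us' /=; apply: IH; rewrite inE uts orbT.
- by apply/allP => u /mem_drop; apply: (allP ous).
- by rewrite map_drop eus drop_size_cat.
Qed.

Lemma graft_id t : graft t (map Id (rsrc t)) = t.
Proof.
elim/rop_ind_in: t => [c|g ts IH] //; rewrite graft_node; congr Node.
rewrite /=; elim: ts IH => //= t ts IHts IH.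
rewrite map_cat take_size_cat ?size_map // drop_size_cat ?size_map //.
rewrite IH ?mem_head // IHts // => u uts.
by apply: IH; rewrite inE uts orbT.
Qed.

Lemma graftA t (ps : seq (rop * seq rop)) :
  size ps = size (rsrc t) ->
  all (fun p => size p.2 == size (rsrc p.1)) ps ->
  graft (graft t [seq p.1 | p <- ps]) (flatten [seq p.2 | p <- ps]) =
  graft t [seq graft p.1 p.2 | p <- ps].
Proof.
elim/rop_ind_in: t ps => [c|g ts IH] ps.
  by case: ps => [|p []] //= _ _; rewrite cats0.
rewrite !graft_node /= => sps aps; congr Node.
elim: ts ps IH sps aps => //= t ts IHts ps IH.
rewrite size_cat => sps aps.
have lem : size (rsrc t) <= size ps by rewrite sps leq_addr.
have s1 := size_takel lem.
have s2 : size (drop (size (rsrc t)) ps) = size (flatten (map rsrc ts)).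
  by rewrite size_drop sps addKn.
have eps := esym (cat_take_drop (size (rsrc t)) ps).
move: s1 s2 eps; move: (take _ ps) (drop _ ps) => ps1 ps2 s1 s2 eps.
move: aps; rewrite {}eps {ps sps lem}.
rewrite all_cat !map_cat flatten_cat => /andP[aps1 aps2].
have sz : size (rsrc (graft t [seq p.1 | p <- ps1])) =
          size (flatten [seq p.2 | p <- ps1]).
  rewrite rsrc_graft ?size_map // !size_flatten /shape -!map_comp.
  by congr sumn; apply/eq_in_map => p /(allP aps1)/eqP.
rewrite !take_size_cat ?size_map // !drop_size_cat ?size_map //.
rewrite IH ?mem_head // IHts //.
by move=> u uts ps'; apply: IH; rewrite inE uts orbT.
Qed.

Definition raise (t : rop) : rop :=
  Node (Adj (level (rmu t)) t) (map Id (rsrc t)).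

Lemma rsrc_raise t : rsrc (raise t) = rsrc t.
Proof. by rewrite /= -map_comp; elim: (rsrc t) => //= c s ->. Qed.

Lemma raiseP n k t : is_op S n t -> rmu t = inl k -> k < n ->
  is_op S n (raise t) /\ rmu (raise t) = inl k.+1.
Proof.
move=> ot mt ltkn; split; last by rewrite /rmu /= mt.
have := is_op_level ot; rewrite /raise mt /= => ot'.
rewrite ltkn ot' mt eqxx -map_comp /= map_id eqxx andbT.
by apply/allP => _ /mapP[c ct ->] /=; apply: (allP (is_op_src ot)).
Qed.

Definition is_obj (n : nat) (x : robj) : bool :=
  match x with
  | inl i => i <= n
  | inr a => is_edge S a && (a != [::])
  end.

Definition robj_le (x y : robj) : bool :=
  match x, y with
  | inl i, inl j => i <= j
  | inr a, inr b => a == b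
  | _, _ => false
  end.

Lemma robj_le_refl x : robj_le x x.
Proof. by case: x => /=. Qed.

Lemma robj_le_trans y x z : robj_le y z -> robj_le x y -> robj_le x z.
Proof.
case: x y z => [x|x] [y|y] [z|z] //=; first by move=> yz xy; apply: leq_trans yz.
by move=> /eqP <- .
Qed.

Lemma is_obj_mu n c : is_col S n c -> is_obj n (rcol_mu c).
Proof. by case: c => [[|i a]|k h] //= => [->|/and3P[]]. Qed.

(* p_{x,y} • t = p_{y-1,y} • (... • (p_{x,x+1} • t)), and t if x = y. *)
Definition ract (x y : robj) (t : rop) : rop := iter (level y - level x) raise t.

Lemma rsrc_ract x y t : rsrc (ract x y t) = rsrc t.
Proof. by rewrite /ract; elim: (_ - _) => // d; rewrite iterS rsrc_raise. Qed.

Lemma ractP n x y t : is_op S n t -> rmu t = x -> robj_le x y -> is_obj n y ->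
  is_op S n (ract x y t) /\ rmu (ract x y t) = y.
Proof.
rewrite /ract; case: x y => [x|x] [y|y] //= ot mt.
  move=> lexy leyn.
  have : x + (y - x) <= n by rewrite subnKC.
  rewrite -[in inl y](subnKC lexy).
  elim: (y - x) => [|d IH] /=; first by rewrite addn0.
  rewrite addnS => ltn; have [od md] := IH (ltnW ltn).
  exact: raiseP od md ltn.
by move/eqP <-.
Qed.

Lemma ract_comp x y z t : robj_le y z -> robj_le x y ->
  ract x z t = ract y z (ract x y t).
Proof.
rewrite /ract -iterD; case: x y z => [x|x] [y|y] [z|z] //= leyz lexy.
by rewrite addnBA // subnK.
Qed.

End RawTheory.

Lemma map_val_pmap (T : Type) (P : pred T) (s : seq T) :
  all P s -> map val (pmap (insub : T -> option {x | P x}) s) = s.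
Proof.
by elim: s => //= x s IH /andP[Px /IH]; rewrite insubT /= => ->.
Qed.

Section Objects.
Variables (n : nat) (S : otree).

(* [n] disjoint union the discrete category on the *_e, e a non-root edge. *)
Definition cn_obj := {x : robj | is_obj S n x}.

Definition cn_cat : category.
Proof.
refine (@Category cn_obj (fun x y => robj_le (val x) (val y))
  (fun x => robj_le_refl (val x)) (fun x y z => @robj_le_trans _ _ _) _ _ _).
- by move=> *; apply: bool_irrelevance.
- by move=> *; apply: bool_irrelevance.
- by move=> *; apply: bool_irrelevance.
Defined.

Lemma cn_thin (x y : Ob cn_cat) (f g : Hom x y) : f = g.
Proof. exact: (@bool_irrelevance (robj_le (val x) (val y))). Qed.

Definition on_col := {c : rcol | is_col S n c}.
Definition on_mor := {t : rop | is_op S n t}.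
Definition gen := {g : rgen | is_gen S n g}.

(* The raw source and target of an element of [on_mor] satisfy [is_col n]. *)
Definition on_src (t : on_mor) : seq on_col := pmap insub (rsrc (val t)).
Definition on_tgt (t : on_mor) : on_col := Sub (rtgt (val t)) (is_op_tgt (valP t)).
Definition on_id (c : on_col) : on_mor :=
  Sub (Id (val c)) (valP c : is_op S n (Id (val c))).

Lemma val_on_src t : map val (on_src t) = rsrc (val t).
Proof. exact/map_val_pmap/is_op_src/valP. Qed.

Lemma on_gamma_tgt t us : map on_tgt us = on_src t ->
  map rtgt (map val us) = rsrc (val t).
Proof. by move=> e; rewrite -val_on_src -e -!map_comp. Qed.

Lemma on_gamma_subproof t us : map on_tgt us = on_src t ->
  is_op S n (graft (val t) (map val us)).
Proof.
move=> e; apply: is_op_graft (on_gamma_tgt e); first exact: valP.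
by rewrite all_map; apply/allP => u _; apply: valP.
Qed.

Definition on_gamma t us (e : map on_tgt us = on_src t) : on_mor :=
  Sub (graft (val t) (map val us)) (on_gamma_subproof e).

(* O_{n,S}; in particular O_{0,S} is the free operad on S. *)
Definition on_operad : operad.
Proof.
refine (@Operad on_col on_mor on_src on_tgt on_id on_gamma _ _ _ _ _ _ _).
- by move=> c; apply: (inj_map val_inj); rewrite val_on_src.
- by move=> c; apply: val_inj.
- move=> t us e; apply: (inj_map val_inj); rewrite val_on_src /= rsrc_graft.
    by rewrite map_flatten -!map_comp; congr flatten; apply: eq_map => u /=;
       rewrite val_on_src.
  by rewrite -(on_gamma_tgt e) !size_map.
- by move=> t us e; apply: val_inj; rewrite /= rtgt_graft ?(on_gamma_tgt e).
- by move=> t e; apply: val_inj.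
- move=> t e; apply: val_inj; rewrite /= -map_comp -[RHS]graft_id -val_on_src.
  by rewrite -map_comp.
- move=> t ps e1 e2 e3; apply: val_inj => /=.
  have := @graftA (val t)
    [seq (val (sval p).1, map val (sval p).2) | p <- ps].
  rewrite -!map_comp map_flatten -!map_comp /comp /=; apply.
    by rewrite size_map -val_on_src size_map -e1 !size_map.
  rewrite all_map; elim: (ps) => //= p ps' ->; rewrite andbT.
  by rewrite size_map -val_on_src size_map -(svalP p) size_map.
Defined.

Definition on_mu (t : on_mor) : cn_obj :=
  Sub (rmu (val t)) (is_obj_mu (is_op_tgt (valP t))).

Lemma on_act_subproof (x y : cn_obj) (f : robj_le (val x) (val y)) t :
  on_mu t = x -> is_op S n (ract (val x) (val y) (val t)) /\
                 rmu (ract (val x) (val y) (val t)) = val y.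
Proof. by move=> e; subst x; apply: ractP f (valP y) => //; apply: valP. Qed.

Definition on_act (x y : cn_obj) (f : robj_le (val x) (val y)) t
    (e : on_mu t = x) : on_mor :=
  Sub (ract (val x) (val y) (val t)) (proj1 (on_act_subproof f e)).

Lemma on_mu_act (x y : cn_obj) (f : robj_le (val x) (val y)) t (e : on_mu t = x) :
  on_mu (on_act f e) = y.
Proof. by apply: val_inj; rewrite /= (proj2 (on_act_subproof f e)). Qed.

(* This is [n ↻ S]. *)
Definition rooted : rooted_action.
Proof.
refine (@RootedAction cn_cat on_operad on_mu on_act on_mu_act _ _ _ _).
- by move=> x y z f f' t e; apply: val_inj => /=; exact: ract_comp.
- by move=> x t e; apply: val_inj; rewrite /= /ract subnn.
- move=> t us e; apply: (val_inj : injective (val : cn_obj -> robj)).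
  by rewrite /= /rmu rtgt_graft ?(on_gamma_tgt e).
- move=> x y f t e; apply: (inj_map val_inj).
  by rewrite !val_on_src /= rsrc_ract.
Defined.

End Objects.

Section Finiteness.

Fixpoint edges (T : ptree) : seq (seq nat) :=
  [::] :: match T with
          | PLeaf => [::]
          | PVertex ts =>
              (fix go i ts := if ts is T' :: ts' then
                 map (cons i) (edges T') ++ go i.+1 ts' else [::]) 0 ts
          end.

Lemma mem_edges T a : isSome (subtree T a) -> a \in edges T.
Proof.
elim: a T => [|i a IH] [|ts] //=; rewrite ?mem_head // inE /=.
rewrite -[i in i :: a]add0n; move: 0.
elim: ts i => [|T ts IHts] [|i] k //=; rewrite mem_cat.
  by move/IH => aT; rewrite addn0 map_f.
by move=> oT; rewrite addnS -addSn IHts // orbT.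
Qed.

Lemma ex_list_dep (A B : eqType) (P : A -> B -> Prop) (s : seq A) :
  {in s, forall a, exists l : seq B, forall b, P a b -> b \in l} ->
  exists l : seq B, forall a b, a \in s -> P a b -> b \in l.
Proof.
elim: s => [|a s IH] Hs; first by exists [::].
have [l1 H1] := Hs a (mem_head _ _).
have [|l2 H2] := IH; first by move=> b bs; apply: Hs; rewrite inE bs orbT.
exists (l1 ++ l2) => c b; rewrite inE mem_cat => /predU1P[->|cs] Pb.
  by rewrite H1.
by rewrite (H2 c) ?orbT.
Qed.

Lemma ex_list_seq (A B : eqType) (Q : pred B) (f : B -> A) (s : seq A) :
  {in s, forall a, exists l : seq B, forall b, Q b -> f b = a -> b \in l} ->
  exists l : seq (seq B), forall bs, all Q bs -> map f bs = s -> bs \in l.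
Proof.
elim: s => [|a s IH] Hs; first by exists [:: [::]] => -[].
have [l1 H1] := Hs a (mem_head _ _).
have [|l2 H2] := IH; first by move=> b bs; apply: Hs; rewrite inE bs orbT.
exists [seq x :: y | x <- l1, y <- l2] => -[//|b bs] /= /andP[Qb Qbs] [fb fbs].
by apply: allpairs_f; [exact: H1 | exact: H2].
Qed.

Variable S : otree.

Lemma fin_edge : exists s : seq (seq nat), forall a, is_edge S a -> a \in s.
Proof.
case: S => [T|]; last by exists [::].
by exists (edges T) => a; apply: mem_edges.
Qed.

Lemma fin_op_tgt n c :
  exists s : seq rop, forall t, is_op S n t -> rtgt t = c -> t \in s.
Proof.
have [es Hes] := fin_edge.
pose D := (\max_(a <- es) size a).+1.
have HD a : is_edge S a -> size a < D.
  by move/Hes => aes; rewrite ltnS; exact: (@leq_bigmax_seq _ es xpredT size a aes).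
pose rank c := match c with Edge a => D - size a | New k _ => D + k.+1 end.
have rank_src g d : is_gen S n g -> d \in rgen_src S g -> is_col S n d ->
    rank d < rank (rgen_tgt g).
  case: g => [a|k h] /=.
    move=> _ /mapP[i _ ->] /= /HD; rewrite size_rcons => ltD.
    by rewrite ltn_sub2l // ltnW.
  case/and3P=> _ oh _ /(allP (is_op_src oh)) + _.
  case: d => [a|k' h'] /=; first by rewrite addnS ltnS (leq_trans (leq_subr _ _)) ?leq_addr.
  by case/andP=> ltk _; rewrite ltn_add2l.
move: {2}(rank c).+1 (ltnSn (rank c)) => r; elim: r c => // r IH c ltr.
pose g := match c with Edge a => Vert a | New k h => Adj k h end.
have [us Hus] : exists us : seq (seq rop), is_gen S n g ->
    forall ts, all (is_op S n) ts -> map rtgt ts = rgen_src S g -> ts \in us.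
  have [gg|] := boolP (is_gen S n g); last by exists [::].
  have [|us Hus] := @ex_list_seq _ _ (is_op S n) rtgt (rgen_src S g); last by exists us.
  move=> d dg; have [cd|ncd] := boolP (is_col S n d); last first.
    by exists [::] => t /is_op_tgt + td; rewrite td (negPf ncd).
  apply: IH; have := rank_src g d gg dg cd.
  by rewrite {1}/g; case: (c) ltr => [a|k h] /= ltr lt; apply: leq_trans lt _.
exists (Id c :: map (Node g) us) => -[c'|g' ts] /= ot ec; first by rewrite ec mem_head.
have eg : g' = g by rewrite /g -ec; case: (g').
rewrite {}eg in ot *; case/and3P: ot => gg ots /eqP ets.
by rewrite inE map_f ?orbT // Hus.
Qed.

Lemma fin_gen n : exists s : seq rgen, forall g, is_gen S n g -> g \in s.
Proof.
have [es Hes] := fin_edge.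
elim: n => [|n [s Hs]].
  exists (map Vert es) => -[a|//] /= va; apply/map_f/Hes.
  exact: (@is_gen_tgt S 0 (Vert a)).
have [|l Hl] := @ex_list_dep _ _ (fun c t => is_op S n t /\ rtgt t = c)
    (map Edge es ++ map rgen_tgt s).
  move=> c _; have [l Hl] := fin_op_tgt n c.
  by exists l => t [ot et]; apply: Hl.
exists (s ++ map (Adj n) l) => -[a|k h] /= gg; rewrite mem_cat.
  by rewrite Hs.
case/and3P: gg; rewrite ltnS leq_eqVlt => /predU1P[->|ltk] oh mh; last first.
  by rewrite Hs //= ltk oh.
rewrite [X in _ || X]map_f ?orbT //; apply: (Hl (rtgt h)) => //.
have := is_op_tgt oh; rewrite mem_cat; case: (rtgt h) => [a|k' h'] /= ch.
  by rewrite map_f // Hes.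
by rewrite [X in _ || X](map_f rgen_tgt (x := Adj k' h')) ?orbT // Hs.
Qed.

Lemma gen_subproof n : exists s : seq (gen n S), forall g, g \in s.
Proof.
have [s Hs] := fin_gen n; exists (pmap insub s) => g.
by rewrite mem_pmap_sub; apply: Hs; apply: valP.
Qed.

Lemma gen_enumP n : Finite.axiom (undup (sval (cid (gen_subproof n)))).
Proof.
apply: Finite.uniq_enumP; first exact: undup_uniq.
by move=> g; rewrite mem_undup; exact: (svalP (cid (gen_subproof n))).
Qed.

End Finiteness.

HB.instance Definition _ n S := Countable.copy (gen n S) {g : rgen | is_gen S n g}.
HB.instance Definition _ n S := isFinite.Build (gen n S) (@gen_enumP S n).

Definition do_obj : Type := nat * otree.

Definition do_hom (X Y : do_obj) : Type :=
  ra_map (rooted X.1 X.2) (rooted Y.1 Y.2).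

Definition do_cat : category :=
  @Category do_obj do_hom (fun X => ra_id (rooted X.1 X.2))
    (fun X Y Z => @ra_comp _ _ _) (fun X Y => @ra_comp1 _ _)
    (fun X Y => @ra_1comp _ _) (fun X Y Z W => @ra_compA _ _ _ _).

Definition degree (X : do_obj) : nat := X.1 + #|{: gen X.1 X.2}|.

Definition edge (S : otree) := {a : seq nat | is_edge S a}.

Definition edge_col n S (e : edge S) : on_col n S :=
  Sub (Edge (val e)) (valP e : is_col S n (Edge (val e))).

Definition ord_obj n S (i : 'I_n.+1) : cn_obj n S :=
  Sub (inl (i : nat)) (ltnSE (ltn_ord i) : is_obj S n (inl (i : nat))).

Section Maps.
Variables (X Y : do_obj) (F : do_hom X Y).

Definition alpha (i : 'I_(X.1).+1) : cn_obj Y.1 Y.2 := mapc F (ord_obj X.2 i).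

Definition beta_hat (c : on_col X.1 X.2) : on_col Y.1 Y.2 := fcol (mapd F) c.

Definition beta (e : edge X.2) : on_col Y.1 Y.2 := beta_hat (edge_col X.1 e).

Definition do_plus : Prop := injective alpha /\ injective beta.

Definition do_minus : Prop :=
  [/\ forall j : 'I_(Y.1).+1, exists i, alpha i = ord_obj Y.2 j,
      forall c, exists c', beta_hat c' = c
    & forall e, is_leaf X.2 (val e) ->
        exists2 e' : edge Y.2, is_leaf Y.2 (val e') & beta e = edge_col Y.1 e'].

End Maps.

Section Reedy.
Variable C : category.

Definition hom_class := forall x y : Ob C, Hom x y -> Prop.

Inductive is_identity (x : Ob C) : forall y, Hom x y -> Prop :=
  IsIdentity : is_identity (idc x).

Definition wide_subcategory (W : hom_class) : Prop :=
  (forall x, W x x (idc x)) /\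
  (forall x y z (g : Hom y z) (f : Hom x y),
     W y z g -> W x y f -> W x z (compc g f)).

Record is_reedy (Rp Rm : hom_class) (d : Ob C -> nat) : Prop := IsReedy {
  reedy_plus : wide_subcategory Rp;
  reedy_minus : wide_subcategory Rm;
  reedy_raise : forall x y (f : Hom x y),
    Rp x y f -> ~ is_identity f -> d x < d y;
  reedy_lower : forall x y (f : Hom x y),
    Rm x y f -> ~ is_identity f -> d y < d x;
  reedy_factor : forall x y (f : Hom x y),
    exists! p : {z : Ob C & (Hom x z * Hom z y)%type},
      [/\ Rm _ _ (projT2 p).1, Rp _ _ (projT2 p).2
        & compc (projT2 p).2 (projT2 p).1 = f]
}.

End Reedy.

(* The degree X |-> n + |gen(n,S)| vanishes on both [0 ↻ ∅] and [0 ↻ η], where *)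
(* η is the tree with one edge and no vertices, although the map [0 ↻ ∅] to    *)
(* [0 ↻ η] is a non-identity map of the direct subcategory.                    *)
Lemma no_col0 c : is_col None 0 c = false.
Proof. by case: c. Qed.

Lemma no_op0 t : is_op None 0 t = false.
Proof. by apply/negP => /is_op_tgt; rewrite no_col0. Qed.

Definition col0_rect (A : Type) (c : on_col 0 None) : A :=
  match notF (etrans (esym (no_col0 (val c))) (valP c)) return A with end.

Definition mor0_rect (A : Type) (t : on_mor 0 None) : A :=
  match notF (etrans (esym (no_op0 (val t))) (valP t)) return A with end.

Lemma obj0_subproof (x : cn_obj 0 None) : is_obj (Some PLeaf) 0 (val x).
Proof. by case: x => -[[]|]. Qed.

Definition empty_to_eta_functor : functor (cn_cat 0 None) (cn_cat 0 (Some PLeaf)).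
Proof.
refine (@Functor (cn_cat 0 None) (cn_cat 0 (Some PLeaf))
  (fun x => Sub (val x) (obj0_subproof x)) (fun x y f => f) _ _).
- by move=> x; apply: cn_thin.
- by move=> x y z g f; apply: cn_thin.
Defined.

Definition empty_to_eta_operad :
  operad_map (on_operad 0 None) (on_operad 0 (Some PLeaf)).
Proof.
refine (@OperadMap (on_operad 0 None) (on_operad 0 (Some PLeaf))
  (col0_rect _) (mor0_rect _) _ _ _ _).
- by move=> t; case: (@mor0_rect False t).
- by move=> t; case: (@mor0_rect False t).
- by move=> c; case: (@col0_rect False c).
- by move=> t; case: (@mor0_rect False t).
Defined.

Definition empty_to_eta : do_hom (0, None) (0, Some PLeaf).
Proof.
refine (@RAMap (rooted 0 None) (rooted 0 (Some PLeaf))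
  empty_to_eta_functor empty_to_eta_operad _ _).
- by move=> t; case: (@mor0_rect False t).
- by move=> x y f t; case: (@mor0_rect False t).
Defined.

Lemma empty_to_eta_plus : do_plus empty_to_eta.
Proof.
split; first by move=> i j _; rewrite !ord1.
by move=> e; case: (@col0_rect False (edge_col 0 e)).
Qed.

Lemma degree_eta : degree (0, Some PLeaf) = 0.
Proof.
rewrite /degree add0n; apply: eq_card0 => -[g gg]; exfalso.
by case: g gg => [[|i a]|k h].
Qed.

Lemma degree_not_reedy : ~ is_reedy (C := do_cat) (@do_plus) (@do_minus) degree.
Proof.
move=> H.
have := @reedy_raise _ _ _ _ H (0, None) (0, Some PLeaf)
  empty_to_eta empty_to_eta_plus.
rewrite degree_eta ltn0 => /(_ _)/notF; apply => eid.
have : (0, None) = (0, Some PLeaf) :> do_obj by case: eid.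
by [].
Qed.

(* [degree], shifted by one to give way to [0 ↻ ∅], which alone keeps 0.  It   *)
(* orders any two objects other than [0 ↻ ∅] as [degree] does.                 *)
Definition shifted_degree (X : do_obj) : nat :=
  if X is (0, None) then 0 else (degree X).+1.

(* Main.v *)
Require Import Defs.
From mathcomp Require Import all_boot.
From mathcomp Require Import boolp.

Set Implicit Arguments.
Unset Strict Implicit.
Unset Printing Implicit Defensive.

(** Every color of O_{n,S} is the output of at most one generating operation,
    so an operation is a tree grown from its output towards its inputs, and the
    inputs lie on pairwise disjoint branches.  Hence an operation is determined
    by its inputs and its output ([op_thin]).  A map [n ↻ S] -> [m ↻ R] is
    therefore determined by its values on the stages 0, ..., n and on the edges
    of S ([ra_map_ext_gen]), and any such values that respect order and moments
    define a map as soon as every vertex of S has an operation to go to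
    ([mk_map]).

    A direct map is injective on all objects and all colors ([eobj_inj],
    [ecol_inj]), hence a monomorphism ([plus_mono]).  It sends a generator to an
    operation other than an identity, and the generators at the roots of these
    operations are pairwise distinct, so it cannot lower the degree.  If the
    degrees agree, all vertices of R are reached; then no vertex of S can be
    sent to an operation with two vertices, because the edge between the two
    would have to be the image of an edge lying strictly inside a vertex
    ([pv_corolla]).  So the map is the identity, unless it is the inclusion of
    [0 ↻ ∅] in [0 ↻ η], for η the tree with one edge ([plus_dichotomy]).

    An inverse map has a section: take the first stage over each stage and the
    edge closest to the root over each edge ([minus_split]).  A section is
    always a direct map, so inverse maps lower the degree because direct maps
    raise it ([minus_lowers]).

    To factor (α, β), replace [n] by the image of α, and S by the tree obtained
    by contracting the unary vertices that β sends to identities: two edges of S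
    have the same image exactly when a chain of such vertices joins them
    ([factorization]).  For uniqueness, let G E = G' E' with sections s of E and
    s' of E'.  As G and G' are monomorphisms, E' s and E s' are mutually inverse,
    and both are direct maps.  The degree cannot rise both ways, so they are
    identities ([factor_unique]). *)

(** * Paths and planar trees *)

Lemma prefix_anti (T : eqType) (s t : seq T) : prefix s t -> prefix t s -> s = t.
Proof.
move=> /prefixP[u ->] /prefixP[v /eqP]; rewrite -catA -{1}(cats0 s) eqseq_cat //.
by rewrite eqxx /=; case: u => //; rewrite cats0.
Qed.

Lemma prefix_comparable (T : eqType) (s t u : seq T) :
  prefix s u -> prefix t u -> prefix s t || prefix t s.
Proof.
elim: u s t => [|z u IH] [|x s] [|y t] //=.
by move=> /andP[/eqP-> ps] /andP[/eqP-> pt]; rewrite eqxx; exact: IH.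
Qed.

Lemma prefix_rcons_eq (T : eqType) (s t : seq T) x :
  prefix s (rcons t x) -> s = rcons t x \/ prefix s t.
Proof.
move/prefixP=> [u]; case/lastP: u => [|u y]; first by rewrite cats0 => ->; left.
by rewrite -rcons_cat => /rcons_inj[-> _]; right; exact: prefix_prefix.
Qed.

Lemma prefix_rconsN (T : eqType) (s : seq T) x : prefix (rcons s x) s = false.
Proof.
by apply/negP => /size_prefix; rewrite size_rcons ltnn.
Qed.

Lemma incomparable_split (T : eqType) (a b : seq T) :
  ~~ prefix a b -> ~~ prefix b a ->
  exists c i j, [/\ i != j, prefix (rcons c i) a & prefix (rcons c j) b].
Proof.
elim: a b => [|x a IH] [|y b] //; rewrite !prefix_cons.
have [<-|nxy] /= := eqVneq x y; last first.
  by exists [::], x, y; rewrite /= !eqxx !prefix0s.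
move=> /IH H /H [c [i [j [nij ai bj]]]].
by exists (x :: c), i, j; rewrite /= eqxx.
Qed.

Lemma uniq_map_inj (T U : eqType) (f : T -> U) s x y :
  uniq (map f s) -> x \in s -> y \in s -> f x = f y -> x = y.
Proof.
elim: s => //= z s IH /andP[zs us]; rewrite !inE.
case/predU1P=> [->|xs] /predU1P[->|ys] // e; last exact: IH.
  by rewrite e map_f in zs.
by rewrite -e map_f in zs.
Qed.

Lemma increasing_id (f : nat -> nat) n :
  (forall i, i < n -> f i < f i.+1) -> f n <= n -> forall i, i <= n -> f i = i.
Proof.
move=> inc fn i lei; apply/eqP; rewrite eqn_leq; apply/andP; split; last first.
  elim: i lei => // i IH lti; exact: leq_ltn_trans (IH (ltnW lti)) (inc i lti).
rewrite -(subKn lei); move: (n - i) (leq_subr i n) => d.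
elim: d => [|d IH] led; first by rewrite subn0.
have ltd : n - d.+1 < n by rewrite ltn_subrL (leq_ltn_trans _ led).
have := IH (ltnW led); rewrite -subnSK // => le1.
by rewrite -ltnS; apply: leq_trans (inc _ ltd) le1.
Qed.

Lemma ptree_ind_onth (P : ptree -> Prop) :
  P PLeaf ->
  (forall ts, (forall i T, onth ts i = Some T -> P T) -> P (PVertex ts)) ->
  forall T, P T.
Proof.
move=> Pleaf Pvertex; fix IH 1; case=> [|ts]; first exact: Pleaf.
apply: Pvertex; elim: ts => [|U ts IHts] [|i] T /=; [discriminate|discriminate| |].
  by case=> <-; exact: (IH U).
exact: (IHts i T).
Qed.

Section TreeEdges.
Variable S : otree.

Lemma subtree_rcons a i :
  subtree_at S (rcons a i) =
  if subtree_at S a is Some (PVertex ts) then onth ts i else None.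
Proof.
rewrite /subtree_at; case: S => //= T.
elim: a T => [|j a IH] [|ts] //=; first by case: (onth ts i).
by case: (onth ts j) => //= U; exact: IH.
Qed.

Lemma edge_rcons a i :
  is_edge S (rcons a i) = is_vertex S a && (i < arity S a).
Proof.
rewrite /is_edge subtree_rcons /is_vertex /arity.
by case: (subtree_at S a) => [[|ts]|] //=; rewrite onthTE.
Qed.

Lemma leaf_edge a : is_leaf S a -> is_edge S a.
Proof. by rewrite /is_leaf /is_edge; case: (subtree_at S a). Qed.

Lemma vertex_edge a : is_vertex S a -> is_edge S a.
Proof. exact: (@is_gen_tgt S 0 (Vert a)). Qed.

Lemma edge_cat a b : is_edge S (a ++ b) -> is_edge S a.
Proof.
elim/last_ind: b => [|b i IH]; first by rewrite cats0.
by rewrite -rcons_cat edge_rcons => /andP[/vertex_edge /IH].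
Qed.

Lemma edge_prefix a b : prefix a b -> is_edge S b -> is_edge S a.
Proof. by case/prefixP=> c ->; exact: edge_cat. Qed.

Definition gen_op (g : rgen) : rop := Node g (map Id (rgen_src S g)).

Lemma gen_op_op n g : is_gen S n g -> is_op S n (gen_op g).
Proof.
move=> gg; rewrite /gen_op /= gg -map_comp (@eq_map _ _ _ id) // map_id eqxx andbT /=.
rewrite all_map; apply/allP => c /=; case: g gg => [a|k h] /=.
  by move=> va /mapP[i + ->] /=; rewrite mem_iota edge_rcons va.
by case/and3P=> ltk oh _ /(allP (is_op_src oh)); apply: is_col_mono; exact: ltnW.
Qed.

Lemma rsrc_gen_op g : rsrc (gen_op g) = rgen_src S g.
Proof. by rewrite /= -map_comp; elim: (rgen_src S g) => //= c s ->. Qed.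

Lemma gen_op_Adj k h : rmu h = inl k -> gen_op (Adj k h) = raise h.
Proof. by rewrite /gen_op /raise => ->. Qed.

End TreeEdges.

Lemma vertex_root S b : is_edge S b -> b != [::] -> is_vertex S [::].
Proof.
case: b => // i b e _; have := edge_prefix (_ : prefix [:: i] (i :: b)) e.
rewrite /= eqxx prefix0s => /(_ isT).
by rewrite -[[:: i]]/(rcons [::] i) edge_rcons => /andP[].
Qed.

(** * The descent order on colors *)

(** Every input of a non-identity operation with output [c] is strictly reached
    from [c].  The order is coarser than descent in one operad: an adjoined
    color reaches every edge and every color of a smaller level.  This makes
    it independent of the tree, and it still separates disjoint branches. *)
Definition sreaches (c d : rcol) : bool :=
  match c, d with
  | Edge a, Edge b => prefix a b && (a != b)
  | Edge _, New _ _ => false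
  | New _ _, Edge _ => true
  | New k _, New k' _ => k' < k
  end.

Definition reaches (c d : rcol) : bool := (c == d) || sreaches c d.

(** Adjoined colors are never independent: an operation with several inputs has
    only edges as inputs. *)
Definition indep (c d : rcol) : bool :=
  match c, d with
  | Edge a, Edge b => ~~ prefix a b && ~~ prefix b a
  | _, _ => false
  end.

Lemma sreaches_irr c : sreaches c c = false.
Proof. by case: c => [a|k h] /=; rewrite ?eqxx ?andbF ?ltnn. Qed.

Lemma reaches_refl c : reaches c c.
Proof. by rewrite /reaches eqxx. Qed.

Lemma sreaches_trans c d e : sreaches c d -> sreaches d e -> sreaches c e.
Proof.
case: c d e => [a|k h] [b|k' h'] [c|k2 h2] //=; last by move=> kk' /ltn_trans; apply.
move=> /andP[ab nab] /andP[bc nbc]; rewrite (prefix_trans ab bc) /=.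
by apply: contraNneq nab => eac; rewrite -eac in bc; rewrite (prefix_anti ab bc).
Qed.

Lemma sreaches_reaches_trans c d e : sreaches c d -> reaches d e -> sreaches c e.
Proof. by move=> cd /predU1P[<-//|]; apply: sreaches_trans. Qed.

Lemma reaches_trans c d e : reaches c d -> reaches d e -> reaches c e.
Proof.
by case/predU1P=> [->//|cd] de; rewrite /reaches (sreaches_reaches_trans cd de) orbT.
Qed.

Lemma reaches_anti c d : reaches c d -> reaches d c -> c = d.
Proof.
case/predU1P=> // cd dc; have := sreaches_reaches_trans cd dc.
by rewrite sreaches_irr.
Qed.

Lemma reaches_Edge a b : reaches (Edge a) (Edge b) = prefix a b.
Proof.
rewrite /reaches /= -(inj_eq (f := Edge)); last by move=> x y [].
case: eqP => [[->]|] /=; [exact/esym/prefix_refl|by rewrite andbT].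
Qed.

Lemma reaches_EdgeP a c : reaches (Edge a) c -> exists2 b, c = Edge b & prefix a b.
Proof.
case: c => [b|k h]; first by rewrite reaches_Edge; exists b.
by case/predU1P.
Qed.

Lemma indep_reaches c d c' d' :
  indep c d -> reaches c c' -> reaches d d' -> indep c' d'.
Proof.
case: c d => [a|//] [b|//] /= /andP[nab nba].
move=> /reaches_EdgeP[a' -> aa'] /reaches_EdgeP[b' -> bb'] /=.
apply/andP; split; apply/negP => p.
  have := prefix_comparable (prefix_trans aa' p) bb'.
  by rewrite (negPf nab) (negPf nba).
have := prefix_comparable (prefix_trans bb' p) aa'.
by rewrite (negPf nab) (negPf nba).
Qed.

Lemma indep_irr c : indep c c = false.
Proof. by case: c => //= a; rewrite prefix_refl. Qed.

Lemma indepC c d : indep c d = indep d c.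
Proof. by case: c d => [a|k h] [b|k' h'] //=; rewrite andbC. Qed.

(** Along a descent the moment drops strictly as long as it is a stage: there is
    one root edge, and an adjoined color reaches no other of its own level. *)
Lemma reaches_mu c d i : reaches c d -> rcol_mu c = inl i -> rcol_mu d = inl i -> c = d.
Proof.
case/predU1P=> //; case: c d => [[|x a]|k h] [[|y b]|k' h'] //=.
  by move=> _ [<-].
by move=> lt [<-] [e]; rewrite e ltnn in lt.
Qed.

Lemma reaches_level c d : reaches c d -> level (rcol_mu d) <= level (rcol_mu c).
Proof.
case/predU1P=> [->//|]; case: c d => [[|x a]|k h] [[|y b]|k' h'] //= lt.
by rewrite ltnS ltnW.
Qed.

Section Operations.
Variable R : otree.

Lemma gen_sreaches n g d :
  is_gen R n g -> d \in rgen_src R g -> sreaches (rgen_tgt g) d.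
Proof.
case: g => [a|k h] /=.
  move=> _ /mapP[i _ ->] /=; rewrite prefix_rcons /=.
  by apply/negP => /eqP e; have := prefix_rconsN a i; rewrite -e prefix_refl.
case/and3P=> _ oh _ /(allP (is_op_src oh)).
by case: d => //= k' h' /andP[].
Qed.

Lemma op_reaches n t d : is_op R n t -> d \in rsrc t -> reaches (rtgt t) d.
Proof.
elim/rop_ind_in: t d => [c|g ts IH] d /=.
  by rewrite inE => _ /eqP->; exact: reaches_refl.
case/and3P=> gg /allP ots /eqP ets /flatten_mapP[t tts dt].
have lt := IH t tts d (ots t tts) dt.
have: rtgt t \in rgen_src R g by rewrite -ets map_f.
by move/(gen_sreaches gg) => lg; rewrite /reaches (sreaches_reaches_trans lg lt) orbT.
Qed.

Lemma node_sreaches n g ts d :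
  is_op R n (Node g ts) -> d \in rsrc (Node g ts) -> sreaches (rgen_tgt g) d.
Proof.
case/and3P=> gg /allP ots /eqP ets /flatten_mapP[t tts dt].
apply: sreaches_reaches_trans (op_reaches (ots t tts) dt).
by apply: gen_sreaches gg _; rewrite -ets map_f.
Qed.

Lemma op_loop n t : is_op R n t -> rtgt t \in rsrc t -> t = Id (rtgt t).
Proof.
case: t => //= g ts ot /(node_sreaches ot).
by rewrite sreaches_irr.
Qed.

(** Disjoint branches stay disjoint when operations are grafted on them. *)
Lemma indep_flatten n ts : all (is_op R n) ts -> pairwise indep (map rtgt ts) ->
  {in ts, forall t, pairwise indep (rsrc t)} ->
  pairwise indep (flatten (map rsrc ts)).
Proof.
elim: ts => //= t ts IH /andP[ot ots] /andP[/allP at_ pts] H.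
rewrite pairwise_cat H ?mem_head //= IH // ?andbT; last first.
  by move=> u uts; apply: H; rewrite inE uts orbT.
apply/allrelP => c d ct /flatten_mapP[u uts du].
apply: (indep_reaches (at_ _ (map_f rtgt uts))); first exact: op_reaches ot ct.
exact: op_reaches (allP ots u uts) du.
Qed.

Lemma indep_src :
  (forall t n, is_op R n t -> pairwise indep (rsrc t)) /\
  (forall g n, is_gen R n g -> pairwise indep (rgen_src R g)).
Proof.
suff [_ H1 H2] : [/\ rcol -> True,
    forall t n, is_op R n t -> pairwise indep (rsrc t)
  & forall g n, is_gen R n g -> pairwise indep (rgen_src R g)] by [].
apply: (@raw_ind (fun=> True)
   (fun t => forall n, is_op R n t -> pairwise indep (rsrc t))
   (fun g => forall n, is_gen R n g -> pairwise indep (rgen_src R g))) => //=.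
- move=> g ts IHg IHts n /and3P[gg ots /eqP ets].
  apply: (indep_flatten ots); first by rewrite ets; apply: IHg gg.
  elim: ts IHts ots {ets} => //= t ts IH [IHt IHts] /andP[ot ots] u.
  rewrite inE => /predU1P[->|uts]; first exact: IHt ot.
  exact: (IH IHts ots).
- move=> a n _; rewrite pairwise_map.
  have := iota_uniq 0 (arity R a); rewrite uniq_pairwise.
  apply: sub_pairwise => i j /= nij.
  rewrite -!cats1 !prefix_catr ?size_cat // !eqxx !prefix_cons !andbT.
  by rewrite eq_sym andbb eq_sym.
- by move=> k h IH n /and3P[_ oh _]; apply: IH oh.
Qed.

Lemma rgen_tgt_inj : injective rgen_tgt.
Proof. by case=> [a|k h] [b|k' h'] //= [->] // ->. Qed.

(** Inputs reachable from the output of the first branch are exactly the inputs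
    of that branch, the other branches being independent of it.  So the list
    of inputs is cut into the branches in only one way, and the branches agree
    by induction. *)
Lemma op_thin n t t' : is_op R n t -> is_op R n t' ->
  rtgt t = rtgt t' -> rsrc t = rsrc t' -> t = t'.
Proof.
elim/rop_ind_in: t t' => [c|g ts IH] t'.
  move=> _ ot' /= ec es; rewrite [t'](op_loop ot') -?ec //.
  by rewrite -es mem_head.
case: t' => [c ot _ /= ec es|g' ts' /[dup] ot].
  by have := op_loop ot; rewrite /= ec es mem_head => /(_ isT).
case/and3P=> gg ots /eqP ets /and3P[gg' ots' /eqP ets'] /rgen_tgt_inj eg es.
rewrite -{}eg in ots' ets' gg' *; congr Node.
have := proj2 indep_src g n gg; rewrite -ets.
move: ets ets' es => <- /=.
elim: ts ts' ots ots' IH {ot} => [|t ts IHts] [|t' ts'] //=.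
move=> /andP[ot ots] /andP[ot' ots'] IH.
move=> [ett etts] es /andP[/allP at_ pts].
have sep (us : seq rop) d : all (is_op R n) us -> map rtgt us = map rtgt ts ->
    d \in flatten (map rsrc us) -> ~~ reaches (rtgt t) d.
  move=> ous eus /flatten_mapP[u uus du]; apply/negP => ld.
  have iu : indep (rtgt t) (rtgt u) by apply: at_; rewrite -eus map_f.
  by have := indep_reaches iu ld (op_reaches (allP ous u uus) du); rewrite indep_irr.
(* Filtering by what [rtgt t] reaches recovers the first branch. *)
have fil u us : is_op R n u -> rtgt u = rtgt t -> all (is_op R n) us ->
    map rtgt us = map rtgt ts ->
    [seq d <- rsrc u ++ flatten (map rsrc us) | reaches (rtgt t) d] = rsrc u.
  move=> ou eu ous eus; rewrite filter_cat -[RHS]cats0; congr (_ ++ _).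
    by apply/all_filterP/allP => d; rewrite -eu; apply: op_reaches ou.
  by apply/eqP; rewrite -[_ == _]negbK -has_filter; apply/hasPn => d; exact: sep.
have e1 : rsrc t = rsrc t'.
  by rewrite -(fil t ts) // es fil.
congr (_ :: _); first by apply: IH; rewrite ?mem_head.
apply: IHts => //; first by move=> u uts u'; apply: IH; rewrite inE uts orbT.
by move: es; rewrite e1 => /eqP; rewrite eqseq_cat // eqxx => /eqP.
Qed.

End Operations.

(** * Maps as values on stages, edges and vertices *)

(** Values of a map on edges, vertices and stages.  They are functions on raw
    syntax, so that their extension is a plain recursion on raw syntax. *)
Record premap := PreMap {
  pe : seq nat -> rcol;
  pv : seq nat -> rop;
  pa : nat -> robj
}.

(** The only extension compatible with the action and with composition: the
    operation adjoined to [h] at stage [k.+1] goes to the image of [h] moved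
    along the image of the step from [k] to [k.+1].  When that step is sent to
    an identity, an adjoined color goes to the image of the output of [h]. *)
Fixpoint ecol (p : premap) (c : rcol) : rcol :=
  match c with
  | Edge a => pe p a
  | New k h => rtgt (ract (pa p k) (pa p k.+1) (eop p h))
  end
with eop (p : premap) (t : rop) : rop :=
  match t with
  | Id c => Id (ecol p c)
  | Node g ts => graft (egen p g) (map (eop p) ts)
  end
with egen (p : premap) (g : rgen) : rop :=
  match g with
  | Vert a => pv p a
  | Adj k h => ract (pa p k) (pa p k.+1) (eop p h)
  end.

Lemma ecol_New p k h : ecol p (New k h) = rtgt (egen p (Adj k h)).
Proof. by []. Qed.

Lemma eop_Id p c : eop p (Id c) = Id (ecol p c).
Proof. by []. Qed.

Lemma eop_Node p g ts : eop p (Node g ts) = graft (egen p g) (map (eop p) ts).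
Proof. by []. Qed.

Lemma egen_Adj p k h :
  egen p (Adj k h) = ract (pa p k) (pa p k.+1) (eop p h).
Proof. by []. Qed.

Definition eobj (p : premap) (x : robj) : robj :=
  match x with
  | inl i => pa p i
  | inr a => rcol_mu (pe p a)
  end.

Record premap_ok (n : nat) (S : otree) (m : nat) (R : otree) (p : premap) : Prop :=
  PremapOk {
    pe_col : forall a, is_edge S a -> is_col R m (pe p a);
    pv_op : forall a, is_vertex S a ->
      [/\ is_op R m (pv p a), rtgt (pv p a) = pe p a
        & rsrc (pv p a) = [seq pe p (rcons a i) | i <- iota 0 (arity S a)]];
    pa_obj : forall i, i <= n -> is_obj R m (pa p i);
    pa_le : forall i j, i <= j -> j <= n -> robj_le (pa p i) (pa p j);
    pe_root : is_edge S [::] -> rcol_mu (pe p [::]) = pa p 0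
  }.

(** The cutting of [us] that underlies [grafts ts us], in the form in which the
    associativity of grafting expects it. *)
Fixpoint pairs (ts us : seq rop) : seq (rop * seq rop) :=
  if ts is t :: ts' then
    (t, take (size (rsrc t)) us) :: pairs ts' (drop (size (rsrc t)) us)
  else [::].

Lemma grafts_pairs ts us : grafts ts us = [seq graft p.1 p.2 | p <- pairs ts us].
Proof. by elim: ts us => //= t ts IH us; rewrite IH. Qed.

Lemma pairs_fst ts us : [seq p.1 | p <- pairs ts us] = ts.
Proof. by elim: ts us => //= t ts IH us; rewrite IH. Qed.

Lemma pairs_snd ts us : size us = size (flatten (map rsrc ts)) ->
  flatten [seq p.2 | p <- pairs ts us] = us.
Proof.
elim: ts us => /= [|t ts IH] us; first by move/size0nil->.
rewrite size_cat => sus; rewrite IH ?cat_take_drop //.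
by rewrite size_drop sus addKn.
Qed.

Lemma pairs_size ts us : size us = size (flatten (map rsrc ts)) ->
  all (fun p => size p.2 == size (rsrc p.1)) (pairs ts us).
Proof.
elim: ts us => //= t ts IH us.
rewrite size_cat => sus; rewrite IH ?andbT ?size_takel ?sus ?leq_addr //.
by rewrite size_drop sus addKn.
Qed.

Lemma grafts_id cs us : size cs = size us -> grafts (map Id cs) us = us.
Proof.
by elim: cs us => [|c cs IH] [|u us] //= [e]; rewrite drop0 IH.
Qed.

Section Extension.
Variables (n : nat) (S : otree) (m : nat) (R : otree) (p : premap).
Hypothesis ok : premap_ok n S m R p.

Lemma edge_mu a : is_edge S a -> rcol_mu (pe p a) = eobj p (rcol_mu (Edge a)).
Proof. by case: a => //=; apply: (pe_root ok). Qed.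

Lemma flatten_eop ts : {in ts, forall t, rsrc (eop p t) = map (ecol p) (rsrc t)} ->
  flatten (map rsrc (map (eop p) ts)) = map (ecol p) (flatten (map rsrc ts)).
Proof.
elim: ts => //= t ts IH H; rewrite map_cat H ?mem_head // IH // => u uts.
by apply: H; rewrite inE uts orbT.
Qed.

(** One induction over colors, operations and generators at once, as each of the
    three occurs inside the other two.  The stage [k] varies because the
    operations below an adjoined color live in an earlier operad. *)
Lemma extension_typed :
  [/\ forall c k, k <= n -> is_col S k c ->
        is_col R m (ecol p c) /\ rcol_mu (ecol p c) = eobj p (rcol_mu c),
      forall t k, k <= n -> is_op S k t ->
        [/\ is_op R m (eop p t), rtgt (eop p t) = ecol p (rtgt t),
            rsrc (eop p t) = map (ecol p) (rsrc t)
          & rmu (eop p t) = eobj p (rmu t)]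
    & forall g k, k <= n -> is_gen S k g ->
        [/\ is_op R m (egen p g), rtgt (egen p g) = ecol p (rgen_tgt g),
            rsrc (egen p g) = map (ecol p) (rgen_src S g)
          & rmu (egen p g) = eobj p (rcol_mu (rgen_tgt g))]].
Proof.
(* Colors and generators adjoined to [h] share this computation. *)
have adj k h : k < n -> rmu h = inl k -> is_op S k h ->
    [/\ is_op R m (eop p h), rtgt (eop p h) = ecol p (rtgt h),
            rsrc (eop p h) = map (ecol p) (rsrc h)
          & rmu (eop p h) = eobj p (rmu h)] ->
    is_op R m (ract (pa p k) (pa p k.+1) (eop p h)) /\
    rmu (ract (pa p k) (pa p k.+1) (eop p h)) = pa p k.+1.
  move=> ltk mh oh [o _ _ mu_]; apply: ractP => //; first by rewrite mu_ mh.
    exact: (pa_le ok).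
  exact: (pa_obj ok).
apply: (@raw_ind
  (fun c => forall k, k <= n -> is_col S k c ->
        is_col R m (ecol p c) /\ rcol_mu (ecol p c) = eobj p (rcol_mu c))
  (fun t => forall k, k <= n -> is_op S k t ->
        [/\ is_op R m (eop p t), rtgt (eop p t) = ecol p (rtgt t),
            rsrc (eop p t) = map (ecol p) (rsrc t)
          & rmu (eop p t) = eobj p (rmu t)])
  (fun g => forall k, k <= n -> is_gen S k g ->
        [/\ is_op R m (egen p g), rtgt (egen p g) = ecol p (rgen_tgt g),
            rsrc (egen p g) = map (ecol p) (rgen_src S g)
          & rmu (egen p g) = eobj p (rcol_mu (rgen_tgt g))])).
- by move=> a k _ /= ea; split; [exact: (pe_col ok)|exact: edge_mu].
- move=> k h IH j lej /and3P[ltk oh /eqP mh].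
  have ltkn := leq_trans ltk lej.
  have [o1 o2] := adj k h ltkn mh oh (IH k (ltnW ltkn) oh).
  by split; first exact: is_op_tgt o1.
- by move=> c IH k lek /= /(IH k lek)[].
- move=> g ts IHg IHts k lek /= /and3P[gg ots /eqP ets].
  have [o1 o2 o3 o4] := IHg k lek gg.
  have H : {in ts, forall t, [/\ is_op R m (eop p t), rtgt (eop p t) = ecol p (rtgt t),
            rsrc (eop p t) = map (ecol p) (rsrc t)
          & rmu (eop p t) = eobj p (rmu t)]}.
    elim: ts IHts ots {ets} => //= t ts IH [IHt IHts] /andP[ot ots] u.
    rewrite inE => /predU1P[->|]; first exact: IHt ot.
    exact: IH.
  have et : map rtgt (map (eop p) ts) = rsrc (egen p g).
    by rewrite o3 -ets -!map_comp; apply/eq_in_map => t /H[].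
  have es : size (map (eop p) ts) = size (rsrc (egen p g)) by rewrite -et !size_map.
  rewrite /rmu /= rtgt_graft // rsrc_graft //; split=> //.
    by apply: is_op_graft => //; rewrite all_map; apply/allP => t /H[].
  by rewrite flatten_eop // => t /H[].
- move=> a k _ /= va; have [o1 o2 o3] := pv_op ok va.
  have ea := @is_gen_tgt S k (Vert a) va.
  rewrite /rmu o2 o3 -map_comp; split=> //; exact: edge_mu ea.
- move=> k h IH j lej /and3P[ltk oh /eqP mh].
  have ltkn := leq_trans ltk lej; have H := IH k (ltnW ltkn) oh.
  have [o1 o2] := adj k h ltkn mh oh H.
  by split=> //; rewrite /= rsrc_ract; case: H.
Qed.

Lemma ecol_col c : is_col S n c -> is_col R m (ecol p c).
Proof. by case: extension_typed => H _ _ /H[]. Qed.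

Lemma ecol_mu c : is_col S n c -> rcol_mu (ecol p c) = eobj p (rcol_mu c).
Proof. by case: extension_typed => H _ _ /H[]. Qed.

Lemma eop_op t : is_op S n t -> is_op R m (eop p t).
Proof. by case: extension_typed => _ H _ /H[]. Qed.

Lemma eop_tgt t : is_op S n t -> rtgt (eop p t) = ecol p (rtgt t).
Proof. by case: extension_typed => _ H _ /H[]. Qed.

Lemma eop_src t : is_op S n t -> rsrc (eop p t) = map (ecol p) (rsrc t).
Proof. by case: extension_typed => _ H _ /H[]. Qed.

Lemma eop_mu t : is_op S n t -> rmu (eop p t) = eobj p (rmu t).
Proof. by case: extension_typed => _ H _ /H[]. Qed.

Lemma egen_op g : is_gen S n g -> is_op R m (egen p g).
Proof. by case: extension_typed => _ _ H /H[]. Qed.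

Lemma egen_tgt g : is_gen S n g -> rtgt (egen p g) = ecol p (rgen_tgt g).
Proof. by case: extension_typed => _ _ H /H[]. Qed.

Lemma egen_src g : is_gen S n g -> rsrc (egen p g) = map (ecol p) (rgen_src S g).
Proof. by case: extension_typed => _ _ H /H[]. Qed.

Lemma eobj_obj x : is_obj S n x -> is_obj R m (eobj p x).
Proof.
case: x => [i|a] /=; first exact: (pa_obj ok).
by case/andP=> /(pe_col ok)/is_obj_mu.
Qed.

Lemma eobj_le x y : is_obj S n y -> robj_le x y -> robj_le (eobj p x) (eobj p y).
Proof.
case: x y => [i|a] [j|b] //=; first by move=> lej leij; apply: (pa_le ok).
by move=> _ /eqP->; exact: robj_le_refl.
Qed.

Lemma eop_graft t us : is_op S n t -> size us = size (rsrc t) ->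
  eop p (graft t us) = graft (eop p t) (map (eop p) us).
Proof.
elim/rop_ind_in: t us => [c|g ts IH] us.
  by case: us => [|u []].
rewrite graft_node => /[dup] ot /and3P[gg ots /eqP ets] /= sus.
have := pairs_size sus; have := pairs_snd sus; have := pairs_fst ts us.
rewrite grafts_pairs; move: (pairs ts us) => qs ets' eus al; subst us.
rewrite map_flatten.
have -> : [seq eop p i | i <- [seq graft q.1 q.2 | q <- qs]] =
   [seq graft q.1 q.2 | q <- [seq (eop p q.1, map (eop p) q.2) | q <- qs]].
  rewrite -!map_comp; apply/eq_in_map => q qp /=.
  have qts : q.1 \in ts by rewrite -ets' map_f.
  by apply: IH => //; [apply: (allP ots)|exact/eqP/(allP al)].
rewrite -graftA; last 2 first.
- by rewrite egen_src // -ets -ets' !size_map.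
- rewrite all_map; apply/allP => q qp /=.
  rewrite eop_src ?size_map ?(allP al) //.
  by apply: (allP ots); rewrite -ets' map_f.
by rewrite -ets' -!map_comp.
Qed.

Lemma eop_raise k t : is_op S n t -> rmu t = inl k -> k < n ->
  eop p (raise t) = ract (pa p k) (pa p k.+1) (eop p t).
Proof.
move=> ot mt ltk; rewrite /raise /= mt /=.
rewrite -[RHS]graft_id rsrc_ract eop_src //; congr graft.
by rewrite -!map_comp.
Qed.

(** The action is an iterated step, so this reduces to a single step, where it
    holds by the choice of the image of an adjoined operation. *)
Lemma eop_ract x y t : is_op S n t -> rmu t = x -> robj_le x y -> is_obj S n y ->
  eop p (ract x y t) = ract (eobj p x) (eobj p y) (eop p t).
Proof.
case: x y => [i|a] [j|b] //= ot mt; last first.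
  by move=> /eqP-> _; rewrite /ract !subnn.
move=> leij lej.
rewrite /ract /= -[in RHS](subnKC leij).
have : i + (j - i) <= n by rewrite subnKC.
elim: (j - i) => [|d IH] led; first by rewrite addn0 subnn.
rewrite addnS in led *; rewrite iterS.
have [o2 o3] := @ractP S n (inl i) (inl (i + d)) t ot mt (leq_addr d i) (ltnW led).
rewrite /ract /= addKn in o2 o3.
rewrite (eop_raise o2 o3) // IH ?(ltnW led) //.
have -> x y : iter (level x - level y) raise (eop p t) = ract y x (eop p t) by [].
by rewrite -ract_comp //; apply: (pa_le ok); rewrite ?leq_addr // ltnW.
Qed.

End Extension.

Section MakeMap.
Variables (n : nat) (S : otree) (m : nat) (R : otree) (p : premap).
Hypothesis ok : premap_ok n S m R p.

Definition mk_functor : functor (cn_cat n S) (cn_cat m R).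
Proof.
refine (@Functor (cn_cat n S) (cn_cat m R)
  (fun x => Sub (eobj p (val x)) (eobj_obj ok (valP x)))
  (fun x y f => eobj_le ok (valP y) f) _ _).
- by move=> x; apply: cn_thin.
- by move=> x y z g f; apply: cn_thin.
Defined.

Definition mk_operad_map : operad_map (on_operad n S) (on_operad m R).
Proof.
refine (@OperadMap (on_operad n S) (on_operad m R)
  (fun c => Sub (ecol p (val c)) (ecol_col ok (valP c)))
  (fun t => Sub (eop p (val t)) (eop_op ok (valP t))) _ _ _ _).
- move=> t; apply: (inj_map val_inj); rewrite val_on_src /= (eop_src ok) ?(valP t) //.
  by rewrite -val_on_src -!map_comp.
- by move=> t; apply: val_inj; rewrite /= (eop_tgt ok) ?(valP t).
- by move=> c; apply: val_inj.
- move=> t us e e'; apply: val_inj => /=.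
  rewrite (eop_graft ok) ?(valP t) //; first by rewrite -!map_comp.
  by rewrite -(on_gamma_tgt e) !size_map.
Defined.

Definition mk_map : ra_map (rooted n S) (rooted m R).
Proof.
refine (@RAMap (rooted n S) (rooted m R) mk_functor mk_operad_map _ _).
- by move=> t; apply: val_inj; rewrite /= -(eop_mu ok) ?(valP t).
- move=> x y f t e e'; apply: val_inj => /=.
  apply: (eop_ract ok) => //; [exact: valP|by rewrite -e|exact: valP].
Defined.

End MakeMap.

Section Analysis.
Variables (n : nat) (S : otree) (m : nat) (R : otree).
Variable F : ra_map (rooted n S) (rooted m R).

(** The default values are never reached on an actual edge, vertex or stage. *)
Definition premap_of : premap :=
  PreMap
    (fun a => oapp (fun c : on_col n S => val (fcol (mapd F) c : on_col m R))
                   (Edge [::]) (insub (Edge a)))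
    (fun a => oapp (fun t : on_mor n S => val (mapd F t : on_mor m R))
                   (Id (Edge [::])) (insub (gen_op S (Vert a))))
    (fun i => oapp (fun x : cn_obj n S => val (mapc F x : cn_obj m R))
                   (inl 0) (insub (inl i))).

Lemma val_mapd_src (t : on_mor n S) : rsrc (val (mapd F t : on_mor m R)) =
  [seq val (fcol (mapd F) c : on_col m R) | c <- on_src t].
Proof.
have := congr1 (map val) (fmor_src (mapd F) t); rewrite -map_comp => <-.
by rewrite -val_on_src.
Qed.

Lemma val_mapd_tgt (t : on_mor n S) :
  rtgt (val (mapd F t : on_mor m R)) = val (fcol (mapd F) (on_tgt t) : on_col m R).
Proof. exact: (congr1 val (fmor_tgt (mapd F) t)). Qed.

Lemma val_mapd_mu (t : on_mor n S) :
  rmu (val (mapd F t : on_mor m R)) = val (mapc F (on_mu t) : cn_obj m R).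
Proof. exact: (esym (congr1 val (mapc_mu F t))). Qed.

Lemma pe_ofE a (ea : is_col S n (Edge a)) :
  pe premap_of a = val (fcol (mapd F) (Sub (Edge a) ea : on_col n S) : on_col m R).
Proof. by rewrite /= insubT. Qed.

Lemma pa_ofE i (oi : is_obj S n (inl i)) :
  pa premap_of i = val (mapc F (Sub (inl i) oi : cn_obj n S) : cn_obj m R).
Proof. by rewrite /= insubT. Qed.

Lemma mapc_le (x y : cn_obj n S) : robj_le (val x) (val y) ->
  robj_le (val (mapc F x : cn_obj m R)) (val (mapc F y : cn_obj m R)).
Proof. by move=> le_xy; apply: (@fhom _ _ (mapc F) x y le_xy). Qed.

Lemma mapd_id (c : on_col n S) :
  val (mapd F (on_id c) : on_mor m R) = Id (val (fcol (mapd F) c : on_col m R)).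
Proof. exact: (congr1 val (fmor_idm (mapd F) c)). Qed.

Lemma mapd_raise k h (oh : is_op S n h) (or : is_op S n (raise h))
   (ok : is_obj S n (inl k)) (ok' : is_obj S n (inl k.+1)) : rmu h = inl k ->
  val (mapd F (Sub (raise h) or : on_mor n S) : on_mor m R) =
  ract (pa premap_of k) (pa premap_of k.+1)
       (val (mapd F (Sub h oh : on_mor n S) : on_mor m R)).
Proof.
move=> mh; rewrite !pa_ofE.
set x := (Sub (inl k) ok : cn_obj n S).
set y := (Sub (inl k.+1) ok' : cn_obj n S).
set h' := (Sub h oh : on_mor n S).
have le_xy : robj_le (val x) (val y) by rewrite /= leqnSn.
have e : on_mu h' = x by apply: val_inj.
have e' : mu (mapd F h') = mapc F x by rewrite -mapc_mu -e.
(* Raising is the action of one step, because the levels differ by one. *)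
have -> : (Sub (raise h) or : on_mor n S) = on_act le_xy e.
  by apply: val_inj; rewrite /= /ract /= subSnn.
by rewrite (@mapd_act _ _ F x y le_xy h' e e').
Qed.

(** A map agrees with the extension of its values on generators, since [Node g ts]
    is the composite of [gen_op S g] with [ts], and [gen_op S (Adj k h)] is the
    action of a step on [h]. *)
Lemma premap_ofE :
  [/\ forall c (cc : is_col S n c),
        val (fcol (mapd F) (Sub c cc : on_col n S) : on_col m R) = ecol premap_of c,
      forall t (ot : is_op S n t),
        val (mapd F (Sub t ot : on_mor n S) : on_mor m R) = eop premap_of t
    & forall g (gg : is_op S n (gen_op S g)),
        val (mapd F (Sub (gen_op S g) gg : on_mor n S) : on_mor m R) =
        egen premap_of g].
Proof.
apply: (@raw_ind (fun c => forall (cc : is_col S n c),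
        val (fcol (mapd F) (Sub c cc : on_col n S) : on_col m R) = ecol premap_of c)
  (fun t => forall (ot : is_op S n t),
        val (mapd F (Sub t ot : on_mor n S) : on_mor m R) = eop premap_of t)
  (fun g => forall (gg : is_op S n (gen_op S g)),
        val (mapd F (Sub (gen_op S g) gg : on_mor n S) : on_mor m R) =
        egen premap_of g)).
- by move=> a ea; rewrite -pe_ofE.
- move=> k h IH cc; have /and3P[ltk oh /eqP mh] := cc.
  have oh' := is_op_mono (ltnW ltk) oh.
  have [or mr] := raiseP oh' mh ltk.
  rewrite -[RHS]/(rtgt (ract (pa premap_of k) (pa premap_of k.+1) (eop premap_of h))).
  rewrite -(IH oh') -(@mapd_raise _ _ _ or (ltnW ltk) ltk mh) val_mapd_tgt.
  have -> // : (Sub (New k h) cc : on_col n S) = on_tgt (Sub (raise h) or : on_mor n S).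
  by apply: val_inj; rewrite /= mh.
- move=> c IH oc; rewrite -[RHS]/(Id (ecol premap_of c)) -(IH oc) -mapd_id.
  have -> // : (Sub (Id c) oc : on_mor n S) = on_id (Sub c oc : on_col n S).
  exact: val_inj.
- move=> g ts IHg IHts ot; have /and3P[gg /[dup] ots /map_val_pmap ots' /eqP ets] := ot.
  have og := gen_op_op gg.
  set g' := (Sub (gen_op S g) og : on_mor n S).
  set ts' := (pmap insub ts : seq (on_mor n S)) in ots'.
  have e : map (@on_tgt n S) ts' = on_src g'.
    apply: (inj_map val_inj); rewrite val_on_src rsrc_gen_op -ets -ots'.
    by rewrite -!map_comp.
  have -> : (Sub (Node g ts) ot : on_mor n S) = on_gamma e.
    apply: val_inj; rewrite /= -/ts' ots' -/(grafts _ _) grafts_id //.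
    by rewrite -ets size_map.
  have e' := operad_map_tgts (mapd F) e.
  apply: (etrans (congr1 val
    (@fmor_gamma (on_operad n S) (on_operad m R) (mapd F) g' ts' e e'))).
  rewrite [RHS]/= -(IHg og) /=; congr graft.
  rewrite -ots' -!map_comp; apply/eq_in_map => -[t ot1] /= tts.
  have {}tts : t \in ts by rewrite -ots'; apply/mapP; exists (exist _ t ot1).
  suff : forall u, u \in ts -> forall ou : is_op S n u,
    val (mapd F (Sub u ou : on_mor n S) : on_mor m R) = eop premap_of u by apply.
  elim: (ts) (IHts) => //= u us IH [IHu IHus] v.
  by rewrite inE => /predU1P[->|/IH]; [exact: IHu|apply].
- by move=> a ga; rewrite /= insubT.
- move=> k h IH og; have /and3P[/and3P[ltk oh /eqP mh] _ _] := og.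
  have oh' := is_op_mono (ltnW ltk) oh.
  have [or mr] := raiseP oh' mh ltk.
  rewrite -[RHS]/(ract (pa premap_of k) (pa premap_of k.+1) (eop premap_of h)).
  rewrite -(IH oh') -(@mapd_raise _ _ _ or (ltnW ltk) ltk mh).
  have -> // : (Sub (gen_op S (Adj k h)) og : on_mor n S) = Sub (raise h) or.
  by apply: val_inj; rewrite !SubK; apply: gen_op_Adj.
Qed.

Lemma val_fcol (c : on_col n S) :
  val (fcol (mapd F) c : on_col m R) = ecol premap_of (val c).
Proof. by case: premap_ofE => H _ _; case: c. Qed.

Lemma val_mapc (x : cn_obj n S) :
  val (mapc F x : cn_obj m R) = eobj premap_of (val x).
Proof.
case: x => -[i|a] ox; first by rewrite /= insubT.
rewrite [RHS]/=; case/andP: (ox) => ea na.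
rewrite insubT /= -[LHS]/(val (mapc F _ : cn_obj m R)).
set e := (Sub (Edge a) ea : on_col n S).
have -> : exist _ (inr a) ox = on_mu (on_id e).
  by apply: val_inj; rewrite /= /rmu /=; case: (a) na.
rewrite -val_mapd_mu mapd_id.
by rewrite /rmu /= -[rcol_mu _]/(rcol_mu (val (fcol (mapd F) _ : on_col m R))).
Qed.

Lemma premap_of_ok : premap_ok n S m R premap_of.
Proof.
split.
- by move=> a ea; rewrite pe_ofE; exact: valP.
- move=> a va; have ga := @gen_op_op S n (Vert a) va.
  have -> : pv premap_of a = val (mapd F (Sub _ ga : on_mor n S) : on_mor m R).
    by rewrite /= insubT.
  split; first exact: valP.
    by rewrite val_mapd_tgt val_fcol.
  rewrite val_mapd_src (eq_map val_fcol) map_comp val_on_src rsrc_gen_op /=.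
  by rewrite -map_comp.
- by move=> i lei; rewrite pa_ofE; exact: valP.
- move=> i j leij lej; have lei := leq_trans leij lej.
  by rewrite (@pa_ofE i lei) (@pa_ofE j lej); apply: mapc_le.
- move=> e0; rewrite pe_ofE (@pa_ofE 0 (leq0n n)).
  set e := (Sub (Edge [::]) _ : on_col n S).
  have := val_mapd_mu (on_id e); rewrite mapd_id /rmu /= => ->.
  have -> // : on_mu (on_id e) =
      (Sub (inl 0) (leq0n n : is_obj S n (inl 0)) : cn_obj n S).
  exact: val_inj.
Qed.

End Analysis.

(** Operations follow colors by [op_thin], and morphisms of the acting category
    follow its objects because it is thin. *)
Lemma ra_map_ext n S m R (F G : ra_map (rooted n S) (rooted m R)) :
  (forall x : cn_obj n S,
     val (mapc F x : cn_obj m R) = val (mapc G x : cn_obj m R)) ->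
  (forall c : on_col n S,
     val (fcol (mapd F) c : on_col m R) = val (fcol (mapd G) c : on_col m R)) ->
  F = G.
Proof.
move=> eo ec.
have eC : fcol (mapd F) = fcol (mapd G) by apply/funext => c; apply: val_inj.
apply: ra_map_eq.
  have : fob (mapc F) = fob (mapc G) by apply/funext => x; apply: val_inj.
  case: (mapc F) => Fo Fh F1 F2; case: (mapc G) => Go Gh G1 G2 /= e.
  subst Go; apply: functor_eq.
  by apply/functional_extensionality_dep => x; apply/functional_extensionality_dep => y;
     apply/funext => f; apply: cn_thin.
apply: operad_map_eq => //; apply/funext => t; apply: val_inj.
apply: (@op_thin R m); [exact: valP|exact: valP| |].
  by rewrite !val_mapd_tgt eC.
by rewrite !val_mapd_src eC.
Qed.

(** The image of an adjoined color depends only on images at earlier stages, and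
    the image of a vertex on the images of its inputs and output. *)
Lemma ra_map_ext_gen n S m R (F G : ra_map (rooted n S) (rooted m R)) :
  (forall i, i <= n -> pa (premap_of F) i = pa (premap_of G) i) ->
  (forall a, is_edge S a -> pe (premap_of F) a = pe (premap_of G) a) ->
  F = G.
Proof.
move=> ea ee.
pose p := premap_of F; pose q := premap_of G.
suff [H1 H2 _] :
  [/\ forall c k, k <= n -> is_col S k c -> ecol p c = ecol q c,
      forall t k, k <= n -> is_op S k t -> eop p t = eop q t
    & forall g k, k <= n -> is_gen S k g -> egen p g = egen q g].
  apply: ra_map_ext => [x|c].
    rewrite !val_mapc; case: x => -[i|a] ox; first exact: ea.
    by have /andP[/ee e _] := ox; exact: (congr1 rcol_mu e).
  by rewrite !val_fcol (H1 _ n) //; exact: valP.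
have okF := premap_of_ok F; have okG := premap_of_ok G.
apply: (@raw_ind
  (fun c => forall k, k <= n -> is_col S k c -> ecol p c = ecol q c)
  (fun t => forall k, k <= n -> is_op S k t -> eop p t = eop q t)
  (fun g => forall k, k <= n -> is_gen S k g -> egen p g = egen q g)).
- by move=> a k _ /ee.
- move=> k h IH j lej /and3P[ltk oh _]; have ltkn := leq_trans ltk lej.
  by rewrite !ecol_New !egen_Adj (IH k (ltnW ltkn) oh) !ea // ltnW.
- by move=> c IH k lek cc; rewrite !eop_Id (IH k lek cc).
- move=> g ts IHg IHts k lek /and3P[gg ots _]; rewrite !eop_Node (IHg k lek gg).
  congr graft; elim: ts IHts ots => //= t ts IH [IHt IHts] /andP[ot ots].
  by rewrite (IHt k lek ot) IH.
- move=> a k _ /= va.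
  have [o1 t1 s1] := pv_op okF va; have [o2 t2 s2] := pv_op okG va.
  apply: (op_thin o1 o2); first by rewrite t1 t2 ee // vertex_edge.
  rewrite s1 s2; apply/eq_in_map => i; rewrite mem_iota => lti.
  by apply: ee; rewrite edge_rcons va.
- move=> k h IH j lej /and3P[ltk oh _]; have ltkn := leq_trans ltk lej.
  by rewrite !egen_Adj (IH k (ltnW ltkn) oh) !ea // ltnW.
Qed.

Section MakeMapValues.
Variables (n : nat) (S : otree) (m : nat) (R : otree) (p : premap).
Hypothesis ok : premap_ok n S m R p.

Lemma pe_mk a : is_edge S a -> pe (premap_of (mk_map ok)) a = pe p a.
Proof. by move=> ea; rewrite (@pe_ofE _ _ _ _ _ a ea). Qed.

Lemma pa_mk i : i <= n -> pa (premap_of (mk_map ok)) i = pa p i.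
Proof. by move=> lei; rewrite (@pa_ofE _ _ _ _ _ i lei). Qed.

End MakeMapValues.

Section CompValues.
Variables (n : nat) (S : otree) (m : nat) (R : otree) (l : nat) (Q : otree).
Variables (G : ra_map (rooted m R) (rooted l Q)) (F : ra_map (rooted n S) (rooted m R)).

Lemma pe_comp a : is_edge S a ->
  pe (premap_of (ra_comp G F)) a = ecol (premap_of G) (pe (premap_of F) a).
Proof. by move=> ea; rewrite !(@pe_ofE _ _ _ _ _ a ea) -val_fcol. Qed.

Lemma pa_comp i : i <= n ->
  pa (premap_of (ra_comp G F)) i = eobj (premap_of G) (pa (premap_of F) i).
Proof. by move=> lei; rewrite !(@pa_ofE _ _ _ _ _ i lei) -val_mapc. Qed.

End CompValues.

(** * Images of edges *)

Section Order.
Variables (n : nat) (S : otree) (m : nat) (R : otree) (p : premap).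
Hypothesis ok : premap_ok n S m R p.

Lemma pe_src a i : is_edge S (rcons a i) -> pe p (rcons a i) \in rsrc (pv p a).
Proof.
rewrite edge_rcons => /andP[va lti]; have [_ _ ->] := pv_op ok va.
by apply/mapP; exists i; rewrite ?mem_iota.
Qed.

Lemma pe_reaches a b : prefix a b -> is_edge S b -> reaches (pe p a) (pe p b).
Proof.
case/prefixP=> c ->; elim/last_ind: c => [|c i IH]; first by rewrite cats0 reaches_refl.
rewrite -rcons_cat => /[dup] e /pe_src src.
have [va _] : is_vertex S (a ++ c) /\ true by move: e; rewrite edge_rcons => /andP[].
apply: reaches_trans (IH (vertex_edge va)) _; have [o <- _] := pv_op ok va.
exact: op_reaches o src.
Qed.

(** The images of two inputs of one vertex are inputs of one operation. *)
Lemma pe_siblings a i j : is_edge S (rcons a i) -> is_edge S (rcons a j) ->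
  i != j -> indep (pe p (rcons a i)) (pe p (rcons a j)).
Proof.
rewrite !edge_rcons => /andP[va lti] /andP[_ ltj].
have [o _ s] := pv_op ok va; have := proj1 (indep_src R) _ _ o.
rewrite s => /(pairwiseP (Edge [::])); rewrite size_map size_iota => H.
have nthE k : k < arity S a ->
    nth (Edge [::]) [seq pe p (rcons a i) | i <- iota 0 (arity S a)] k =
    pe p (rcons a k).
  by move=> ltk; rewrite (nth_map 0) ?size_iota // nth_iota.
rewrite neq_ltn => /orP[] lt; last rewrite indepC.
  by have := H i j lti ltj lt; rewrite !nthE.
by have := H j i ltj lti lt; rewrite !nthE.
Qed.

(** Incomparable edges descend from different inputs of the vertex where their
    paths separate. *)
Lemma pe_indep a b : is_edge S a -> is_edge S b ->
  ~~ prefix a b -> ~~ prefix b a -> indep (pe p a) (pe p b).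
Proof.
move=> ea eb nab nba; have [c [i [j [nij ai bj]]]] := incomparable_split nab nba.
have sib := pe_siblings (edge_prefix ai ea) (edge_prefix bj eb) nij.
exact: indep_reaches sib (pe_reaches ai ea) (pe_reaches bj eb).
Qed.

Lemma pe_comparable a b : is_edge S a -> is_edge S b ->
  reaches (pe p a) (pe p b) -> prefix a b || prefix b a.
Proof.
move=> ea eb ab; apply/negPn; rewrite negb_or; apply/negP => /andP[nab nba].
have := indep_reaches (pe_indep ea eb nab nba) ab (reaches_refl _).
by rewrite indep_irr.
Qed.

Lemma pv_Id a : is_vertex S a -> pe p a \in rsrc (pv p a) -> pv p a = Id (pe p a).
Proof. by move=> /(pv_op ok)[o <- _] /(op_loop o). Qed.

End Order.

Lemma mu_inr c e : rcol_mu c = inr e -> c = Edge e.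
Proof. by case: c => [[|x a]|k h] //= [->]. Qed.

Lemma robj_le_anti x y : robj_le x y -> robj_le y x -> x = y.
Proof.
case: x y => [i|a] [j|b] //=; last by move=> /eqP->.
by move=> ij ji; congr inl; apply/eqP; rewrite eqn_leq ij.
Qed.

Lemma raise_inj : injective raise.
Proof. by move=> t t' [_ ->]. Qed.

Lemma iter_raise_inj d : injective (iter d raise).
Proof. by elim: d => //= d IH t t' /raise_inj /IH. Qed.

(** * Direct maps are monomorphisms *)

Section Injective.
Variables (n : nat) (S : otree) (m : nat) (R : otree) (p : premap).
Hypothesis ok : premap_ok n S m R p.
Hypothesis pa_inj : forall i j, i <= n -> j <= n -> pa p i = pa p j -> i = j.
Hypothesis pe_inj : forall a b, is_edge S a -> is_edge S b -> pe p a = pe p b -> a = b.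

(** The image of a non-root edge is strictly reached from the image of the root,
    whose moment is the image of 0.  So its moment is a smaller stage, or
    belongs to another edge. *)
Lemma pa_neq_mu i a : i <= n -> is_edge S a -> a != [::] -> pa p i <> rcol_mu (pe p a).
Proof.
move=> lei ea na e; have e0 := edge_prefix (prefix0s a) ea.
suff H : pe p [::] = pe p a by move/eqP: na; apply; rewrite (pe_inj e0 ea H).
have lea := pe_reaches ok (prefix0s a) ea.
have mu0 := pe_root ok e0.
have := pa_le ok (leq0n i) lei; rewrite e.
case E0 : (pa p 0) => [j0|b]; case E : (rcol_mu (pe p a)) => [j|b'] //=; last first.
  move=> /eqP eb; rewrite E0 in mu0.
  by rewrite (mu_inr mu0) (mu_inr E) eb.
have := reaches_level lea; rewrite mu0 E0 E /= => le1 le2.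
have ej : j0 = j by apply/eqP; rewrite eqn_leq le2.
by apply: reaches_mu lea (etrans mu0 E0) _; rewrite ej.
Qed.

Lemma eobj_inj x y : is_obj S n x -> is_obj S n y -> eobj p x = eobj p y -> x = y.
Proof.
case: x y => [i|a] [j|b] /=.
- by move=> lei lej /(pa_inj lei lej)->.
- by move=> lei /andP[eb nb] /(pa_neq_mu lei eb nb).
- by move=> /andP[ea na] lej /esym /(pa_neq_mu lej ea na).
move=> /andP[ea na] /andP[eb nb] e; congr inr; apply: pe_inj => //.
case E : (rcol_mu (pe p a)) => [i|c]; last first.
  by rewrite (mu_inr E); rewrite E in e; rewrite (mu_inr (esym e)).
have Eb : rcol_mu (pe p b) = inl i by rewrite -e.
have [ab|nab] := boolP (prefix a b); first exact: reaches_mu (pe_reaches ok ab eb) E Eb.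
have [ba|nba] := boolP (prefix b a).
  exact/esym/(reaches_mu (pe_reaches ok ba ea) Eb E).
have := pe_indep ok ea eb nab nba.
by move: E Eb; case: (pe p a) (pe p b) => [[|? ?]|? ?] [[|? ?]|? ?].
Qed.

Lemma pa_step k : k < n -> exists i j, [/\ pa p k = inl i, pa p k.+1 = inl j & i < j].
Proof.
move=> ltk; have := pa_le ok (leqnSn k) ltk.
have : pa p k <> pa p k.+1 by move/(pa_inj (ltnW ltk) ltk)/n_Sn.
case: (pa p k) (pa p k.+1) => [i|a] [j|b] //= ne; last first.
  by move/eqP=> e; case: ne; rewrite e.
move=> leij; exists i, j; split=> //; rewrite ltn_neqAle leij andbT.
by apply/eqP => e; apply: ne; rewrite e.
Qed.

(** Injectivity on colors gives injectivity on operations, by [op_thin]. *)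
Lemma eop_inj_at k : k <= n ->
  (forall c c', is_col S k c -> is_col S k c' -> ecol p c = ecol p c' -> c = c') ->
  forall t t', is_op S k t -> is_op S k t' -> eop p t = eop p t' -> t = t'.
Proof.
move=> lek ci t t' ot ot' e; apply: (op_thin ot ot').
  apply: ci; rewrite ?is_op_tgt // -!(eop_tgt ok) ?e //;
    by [apply: is_op_mono ot' | apply: is_op_mono ot].
have es : map (ecol p) (rsrc t) = map (ecol p) (rsrc t').
  by rewrite -!(eop_src ok) ?e //; [apply: is_op_mono ot' | apply: is_op_mono ot].
apply: (inj_in_map (A := is_col S k)) es; last 2 first; rewrite ?inE.
- exact: is_op_src.
- exact: is_op_src.
by move=> c c'; exact: ci.
Qed.

(** Moments tell the images of the colors adjoined at different stages apart, and
    tell them from images of edges.  The color adjoined to [h] goes to a color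
    that has the image of [h] as a part, which allows induction on the stage. *)
Lemma ecol_inj_at k : k <= n -> forall c c',
  is_col S k c -> is_col S k c' -> ecol p c = ecol p c' -> c = c'.
Proof.
elim: k => [|k IH] lek.
  by move=> [a|k h] [b|k' h'] //= ea eb /(pe_inj ea eb)->.
have key a i h : is_edge S a -> is_col S k.+1 (New i h) -> pe p a <> ecol p (New i h).
  move=> ea /(is_col_mono lek) /[dup] cc /andP[lti _] e.
  have := ecol_mu ok cc; rewrite -e /=.
  have [->|na] := eqVneq a [::] => e1; last exact: (pa_neq_mu lti ea na (esym e1)).
  have e0 := edge_prefix (prefix0s a) ea.
  by rewrite (pe_root ok e0) in e1; have := pa_inj (leq0n n) lti e1.
case=> [a|i h] [b|i' h'].
- by move=> ea eb /(pe_inj ea eb)->.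
- by move=> ea cc /(key _ _ _ ea cc).
- by move=> cc eb /esym /(key _ _ _ eb cc).
move=> c1 c2 e; have cc1 := is_col_mono lek c1; have cc2 := is_col_mono lek c2.
have /and3P[lti oh mh] := c1; have /and3P[lti' oh' mh'] := c2.
have ltin := leq_trans lti lek; have ltin' := leq_trans lti' lek.
have ei : i = i'.
  have := ecol_mu ok cc1; rewrite e (ecol_mu ok cc2) => e1.
  by case: (pa_inj ltin' ltin e1).
subst i'; have [x [y [ex ey ltxy]]] := pa_step ltin.
move: e; rewrite !ecol_New !egen_Adj ex ey /ract /= -[y - x]prednK ?subn_gt0 // !iterS.
case=> _ /iter_raise_inj eh.
congr New; rewrite ltnS in lti.
by apply: (eop_inj_at (ltnW lek) (IH (ltnW lek))) eh;
   [apply: is_op_mono oh | apply: is_op_mono oh'].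
Qed.

Lemma ecol_inj c c' : is_col S n c -> is_col S n c' -> ecol p c = ecol p c' -> c = c'.
Proof. exact: ecol_inj_at. Qed.

End Injective.

Section TypedClasses.
Variables (X Y : do_obj) (F : do_hom X Y).

Lemma val_alpha (i : 'I_(X.1).+1) : val (alpha F i) = pa (premap_of F) i.
Proof. by rewrite /alpha val_mapc. Qed.

Lemma val_beta (e : edge X.2) : val (beta F e) = pe (premap_of F) (val e).
Proof. by rewrite /beta /beta_hat val_fcol. Qed.

Lemma do_plusP : do_plus F <->
  (forall i j, i <= X.1 -> j <= X.1 ->
     pa (premap_of F) i = pa (premap_of F) j -> i = j) /\
  (forall a b, is_edge X.2 a -> is_edge X.2 b ->
     pe (premap_of F) a = pe (premap_of F) b -> a = b).
Proof.
split=> -[Ha Hb]; split.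
- move=> i j lei lej e; have /Ha/(congr1 val) // :
    alpha F (Ordinal (lei : i < X.1.+1)) = alpha F (Ordinal (lej : j < X.1.+1)).
  by apply: val_inj; rewrite !val_alpha.
- move=> a b ea eb e; have /Hb/(congr1 val) // : beta F (Sub a ea) = beta F (Sub b eb).
  by apply: val_inj; rewrite !val_beta.
- move=> i j /(congr1 val); rewrite !val_alpha => e; apply: val_inj.
  by apply: Ha e; rewrite -ltnS.
- move=> a b /(congr1 val); rewrite !val_beta => e; apply: val_inj.
  by apply: Hb e; exact: valP.
Qed.

Lemma do_minusP : do_minus F <->
  [/\ forall j, j <= Y.1 -> exists2 i, i <= X.1 & pa (premap_of F) i = inl j,
      forall c, is_col Y.2 Y.1 c ->
        exists2 c', is_col X.2 X.1 c' & ecol (premap_of F) c' = c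
    & forall a, is_leaf X.2 a ->
        exists2 b, is_leaf Y.2 b & pe (premap_of F) a = Edge b].
Proof.
split=> -[H1 H2 H3]; split.
- move=> j lej; have [i /(congr1 val)] := H1 (Ordinal (lej : j < Y.1.+1)).
  by rewrite val_alpha => e; exists i; rewrite // -ltnS.
- move=> c cc; have [c' /(congr1 val)] := H2 (Sub c cc).
  by rewrite val_fcol => e; exists (val c'); first exact: valP.
- move=> a la; have [b lb /(congr1 val)] := H3 (Sub a (leaf_edge la)) la.
  by rewrite val_beta => e; exists (val b).
- move=> j; have [|i lei e] := H1 j; first by rewrite -ltnS.
  by exists (Ordinal (lei : i < X.1.+1)); apply: val_inj; rewrite val_alpha.
- move=> c; have [c' cc' e] := H2 _ (valP c).
  by exists (Sub c' cc'); apply: val_inj; rewrite val_fcol.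
- move=> e le; have [b lb eb] := H3 _ le.
  exists (Sub b (leaf_edge lb)) => //.
  by apply: val_inj; rewrite val_beta.
Qed.

End TypedClasses.

Lemma plus_mono X Y Z (G : do_hom Y Z) (E E' : do_hom X Y) :
  do_plus G -> ra_comp G E = ra_comp G E' -> E = E'.
Proof.
case/do_plusP=> Ha Hb eGE; have ok := premap_of_ok G.
have okE := premap_of_ok E; have okE' := premap_of_ok E'.
apply: ra_map_ext_gen => [i lei|a ea].
  apply: (eobj_inj ok Ha Hb); [exact: (pa_obj okE)|exact: (pa_obj okE')|].
  by rewrite -!pa_comp // eGE.
apply: (ecol_inj ok Ha Hb); [exact: (pe_col okE)|exact: (pe_col okE')|].
by rewrite -!pe_comp // eGE.
Qed.

(** * Direct maps raise the degree *)

Lemma rcol_mu_Edge0 c : rcol_mu c = inl 0 -> c = Edge [::].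
Proof. by case: c => [[|x a]|k h]. Qed.

Section Corolla.
Variables (n : nat) (S : otree) (m : nat) (R : otree) (p : premap).
Hypothesis ok : premap_ok n S m R p.
Hypothesis hit : forall b, is_vertex R b -> exists2 e, is_edge S e & pe p e = Edge b.

(** Suppose that a vertex [Vert (rcons b i)] occurs in the image of [Vert a] above
    its root vertex [Vert b].  Its output edge is the image of an edge [e] of S.
    As [e] and [a] have comparable images, [e] is above some input of [a]; but
    the image of that input is strictly above [rcons b i]. *)
Lemma pv_corolla a b : is_vertex S a -> pe p a = Edge b ->
  pv p a = Id (Edge b) \/ is_vertex R b /\ pv p a = gen_op R (Vert b).
Proof.
move=> va eb; have [o t s] := pv_op ok va.
case E : (pv p a) => [c|g us]; first by left; move: t; rewrite E eb /= => ->.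
right; rewrite E in o t; move: t; rewrite eb /=.
case: g E o => // b' E o [e]; subst b'.
have /and3P[gb /allP ous /eqP eus] := o; split=> //; rewrite /gen_op; congr Node.
have uniq_us : uniq (map rtgt us).
  rewrite eus /= map_inj_uniq ?iota_uniq // => i j [/eqP].
  by rewrite eqseq_rcons eqxx => /eqP.
rewrite -eus -map_comp -[LHS]map_id; apply/eq_in_map => u uus /=.
case Eu : u (uus) (ous u uus) => [c|g ts] // uus' ou; exfalso.
have : rtgt u \in rgen_src R (Vert b) by rewrite -eus map_f.
case/mapP=> i lti eu; rewrite Eu /= in eu.
case: g Eu eu ou uus' => // b1 Eu [eb1] ou uus'; subst b1.
have /and3P[vbi _ _] := ou; have [e ee pee] := hit vbi.
have lae : reaches (pe p a) (pe p e) by rewrite eb pee reaches_Edge prefix_rcons.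
have ea := vertex_edge va.
have ea_ : prefix e a = false.
  apply/negP => pea; have := pe_reaches ok pea ea.
  by rewrite pee eb reaches_Edge prefix_rconsN.
have := pe_comparable ok ea ee lae; rewrite ea_ orbF => /prefixP[[|j w] ew].
  by move: ea_; rewrite ew cats0 prefix_refl.
have pj : prefix (rcons a j) e by rewrite ew -cat_rcons prefix_prefix.
have ej := edge_prefix pj ee.
have := pe_src ok ej; rewrite E => /flatten_mapP[u' u'us dj].
have lj := pe_reaches ok pj ee; rewrite pee in lj.
have lu := reaches_trans (op_reaches (ous u' u'us) dj) lj.
have eu' : rtgt u' = rtgt u.
  have : rtgt u' \in rgen_src R (Vert b) by rewrite -eus map_f.
  case/mapP=> i' lti' eu'; move: lu; rewrite eu' reaches_Edge Eu /=.
  by case/prefix_rcons_eq=> [->//|]; rewrite prefix_rconsN.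
(* The branch that contains the image of the input is the one under study. *)
have euu := uniq_map_inj uniq_us u'us uus eu'.
rewrite euu Eu in dj.
have := sreaches_reaches_trans (node_sreaches ou dj) lj.
by rewrite sreaches_irr.
Qed.

End Corolla.

(** The value at identities is a dummy: [root_gen] is applied only to images of
    generators under direct maps. *)
Definition root_gen (t : rop) : rgen := if t is Node g _ then g else Vert [::].

Section GeneratorCount.
Variables (n : nat) (S : otree) (m : nat) (R : otree) (p : premap).
Hypothesis ok : premap_ok n S m R p.
Hypothesis pa_inj : forall i j, i <= n -> j <= n -> pa p i = pa p j -> i = j.
Hypothesis pe_inj : forall a b, is_edge S a -> is_edge S b -> pe p a = pe p b -> a = b.

(** The stages go to a strictly increasing sequence of stages, except that for
    [n = 0] the single stage can go to a non-root edge. *)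
Lemma plus_stages_le : n <= m.
Proof.
case: n ok pa_inj => // n' ok' pa_inj'.
have H i : i <= n'.+1 -> exists2 j, pa p i = inl j & i <= j.
  elim: i => [_|i IH lti].
    by have [x [y [ex _ _]]] := pa_step ok' pa_inj' (ltn0Sn n'); exists x.
  have [x [y [ex ey lt]]] := pa_step ok' pa_inj' lti; exists y => //.
  have [x' ex'] := IH (ltnW lti); rewrite ex in ex'; case: ex' => <- lei.
  exact: leq_ltn_trans lei lt.
have [j ej lej] := H _ (leqnn _); apply: leq_trans lej _.
by have := pa_obj ok' (leqnn _); rewrite ej.
Qed.

(** The image of a generator is not an identity: its output differs from its
    inputs, and the map is injective on colors. *)
Lemma egen_root g : is_gen S n g ->
  is_gen R m (root_gen (egen p g)) /\
  rgen_tgt (root_gen (egen p g)) = ecol p (rgen_tgt g).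
Proof.
move=> gg; have o := egen_op ok gg; rewrite -(egen_tgt ok gg).
have s := egen_src ok gg; have t := egen_tgt ok gg.
case E : (egen p g) => [c|g' us]; last by rewrite E in o; case/and3P: o.
exfalso; move: s t; rewrite E /=; case Es : (rgen_src S g) => [|d [|]] //= [->] e.
have dg : d \in rgen_src S g by rewrite Es mem_head.
have := gen_sreaches gg dg; suff -> : d = rgen_tgt g by rewrite sreaches_irr.
apply: (ecol_inj ok pa_inj pe_inj) e; last exact: is_gen_tgt.
by apply: (allP (is_op_src (gen_op_op gg))); rewrite rsrc_gen_op.
Qed.

Lemma egen_root_inj g g' : is_gen S n g -> is_gen S n g' ->
  root_gen (egen p g) = root_gen (egen p g') -> g = g'.
Proof.
move=> gg gg' e; apply: rgen_tgt_inj.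
apply: (ecol_inj ok pa_inj pe_inj); [exact: is_gen_tgt|exact: is_gen_tgt|].
by rewrite -(egen_root gg).2 -(egen_root gg').2 e.
Qed.

Definition root_map (g : gen n S) : gen m R :=
  Sub (root_gen (egen p (val g))) (egen_root (valP g)).1.

Lemma root_map_inj : injective root_map.
Proof.
move=> g g' /(congr1 val) /= e; apply: val_inj.
exact: egen_root_inj (valP g) (valP g') e.
Qed.

Lemma plus_gens_le : #|{: gen n S}| <= #|{: gen m R}|.
Proof. exact: leq_card root_map_inj. Qed.

Lemma plus_gens_onto : #|{: gen m R}| <= #|{: gen n S}| ->
  forall g', is_gen R m g' ->
    exists2 g, is_gen S n g & ecol p (rgen_tgt g) = rgen_tgt g'.
Proof.
move=> le g' gg'.
have /codomP[g eg] := inj_card_onto root_map_inj le (Sub g' gg' : gen m R).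
exists (val g); first exact: valP.
by rewrite -(egen_root (valP g)).2; have /= -> := congr1 val eg.
Qed.

End GeneratorCount.

Lemma no_gen n g : is_gen None n g = false.
Proof.
suff [_ _ H] : [/\ forall c n, is_col None n c = false,
  forall t n, is_op None n t = false & forall g n, is_gen None n g = false] by [].
apply: (@raw_ind (fun c => forall n, is_col None n c = false)
  (fun t => forall n, is_op None n t = false)
  (fun g => forall n, is_gen None n g = false)) => //=.
- by move=> k h H n'; rewrite H !andbF.
- by move=> g' ts H _ n'; rewrite H.
- by move=> k h H n'; rewrite H !andbF.
Qed.

(** A direct map out of a nonempty tree that preserves the number of stages and
    hits the output of every generator is the identity. *)
Section Rigid.
Variables (n : nat) (S : otree) (R : otree) (p : premap).
Hypothesis ok : premap_ok n S n R p.
Hypothesis pa_inj : forall i j, i <= n -> j <= n -> pa p i = pa p j -> i = j.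
Hypothesis pe_inj : forall a b, is_edge S a -> is_edge S b -> pe p a = pe p b -> a = b.

Lemma rigid_pa : (exists j, pa p 0 = inl j) -> forall i, i <= n -> pa p i = inl i.
Proof.
case=> j0 e0 i lei.
have e k : k <= n -> pa p k = inl (level (pa p k)).
  case: k => [|k] ltk; first by rewrite e0.
  by have [x [y [_ -> _]]] := pa_step ok pa_inj ltk.
rewrite e //; congr inl; move: i lei; apply: increasing_id.
  by move=> i lti; have [x [y [-> ->]]] := pa_step ok pa_inj lti.
by have := pa_obj ok (leqnn n); rewrite [pa p n]e.
Qed.

Hypothesis onto : forall g', is_gen R n g' ->
  exists2 g, is_gen S n g & ecol p (rgen_tgt g) = rgen_tgt g'.
Hypothesis eS : is_edge S [::].

(** If the stage 0 went to a non-root edge, the root vertex of R would not be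
    reached. *)
Lemma rigid_pa0 : exists j, pa p 0 = inl j.
Proof.
case E : (pa p 0) => [j|b]; first by exists j.
exfalso; have [n0|ltn] := posnP n; last first.
  by have [x [y []]] := pa_step ok pa_inj ltn; rewrite E.
have eb := mu_inr (etrans (pe_root ok eS) E).
have := pa_obj ok (leq0n n); rewrite E => /andP[edb nb].
have [g gg] := @onto (Vert [::]) (vertex_root edb nb).
case: g gg => [a|k h]; last by rewrite /= n0.
move=> /= /vertex_edge ea eq; have := pe_reaches ok (prefix0s a) ea.
by rewrite eb eq reaches_Edge prefixs0 (negPf nb).
Qed.

Lemma rigid_root : pe p [::] = Edge [::].
Proof. by apply: rcol_mu_Edge0; rewrite (pe_root ok eS) (rigid_pa rigid_pa0). Qed.

(** Only an edge can go to an edge: the moments of adjoined colors are positive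
    and stages are fixed. *)
Lemma rigid_hit b : is_vertex R b -> exists2 a, is_vertex S a & pe p a = Edge b.
Proof.
move=> vb; have [[a|k h] gg e] := @onto (Vert b) vb; first by exists a.
have /and3P[ltk _ _] := gg; have := ecol_mu ok (is_gen_tgt gg).
rewrite e /= (rigid_pa rigid_pa0) //; by case: (b).
Qed.

Lemma rigid_corolla a b : is_vertex S a -> pe p a = Edge b ->
  [/\ is_vertex R b, arity S a = arity R b
    & forall i, i < arity S a -> pe p (rcons a i) = Edge (rcons b i)].
Proof.
move=> va eb; have [o t s] := pv_op ok va.
have hit b' : is_vertex R b' -> exists2 e, is_edge S e & pe p e = Edge b'.
  by case/rigid_hit=> a' /vertex_edge; exists a'.
have [e|[vb e]] := pv_corolla ok hit va eb.
  exfalso; move: s; rewrite e /=; case Ea : (arity S a) => [|[|]] //= [e'].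
  have ea0 : is_edge S (rcons a 0) by rewrite edge_rcons va Ea.
  have := prefix_rconsN a 0; rewrite (pe_inj ea0 (vertex_edge va)) ?prefix_refl //.
  by rewrite eb e'.
have E : [seq pe p (rcons a i) | i <- iota 0 (arity S a)] = rgen_src R (Vert b).
  by rewrite -s e rsrc_gen_op.
have ar : arity S a = arity R b by have := congr1 size E; rewrite !size_map !size_iota.
split=> // i lti; have := congr1 (fun s => nth (Edge [::]) s i) E.
by rewrite /= !(nth_map 0) ?size_iota -?ar // nth_iota.
Qed.

(** Corollas go to corollas, and leaves to leaves because the vertices of R are
    images of vertices, and edges have distinct images. *)
Lemma rigid_subtree T a b : subtree_at S a = Some T -> is_edge R b ->
  pe p a = Edge b -> subtree_at R b = Some T.
Proof.
elim/ptree_ind_onth: T a b => [|ts IH] a b Sa eb pab.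
  case Rb : (subtree_at R b) => [[|us]|] //; last by move: eb; rewrite /is_edge Rb.
  have [|a' va' pa'b] := @rigid_hit b; first by rewrite /is_vertex Rb.
  have e := pe_inj (vertex_edge va') (_ : is_edge S a) (etrans pa'b (esym pab)).
  by move: va'; rewrite e /is_vertex ?Sa // /is_edge Sa.
have va : is_vertex S a by rewrite /is_vertex Sa.
have [vb ar H] := rigid_corolla va pab.
case Rb : (subtree_at R b) vb => [[|us]|] //; rewrite /is_vertex Rb // => _.
have sz : size ts = size us by move: ar; rewrite /arity Sa Rb.
congr (Some (PVertex _)); apply: eq_from_onth => i.
have [lti|gei] := ltnP i (size ts); last by rewrite !onth_default -?sz.
have : onth ts i by rewrite onthTE.
case Ti : (onth ts i) => [T|] // _.
have Sai : subtree_at S (rcons a i) = Some T by rewrite subtree_rcons Sa.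
have ebi : is_edge R (rcons b i) by rewrite edge_rcons /is_vertex /arity Rb -sz.
have := IH i T Ti _ _ Sai ebi; rewrite subtree_rcons Rb; apply.
by apply: H; rewrite /arity Sa.
Qed.

Lemma rigid_tree : S = R.
Proof.
have e0 : is_edge R [::] by have := pe_col ok eS; rewrite rigid_root.
case ES : (subtree_at S [::]) => [T|]; last by move: eS; rewrite /is_edge ES.
have := rigid_subtree ES e0 rigid_root; move: ES.
by rewrite /subtree_at; case: (S) (R) => [?|] [?|] //= [->] [->].
Qed.

Lemma rigid_edge a : is_edge S a -> pe p a = Edge a.
Proof.
elim/last_ind: a => [|a i IH]; first by rewrite rigid_root.
rewrite edge_rcons => /andP[va lti].
have [_ _ H] := rigid_corolla va (IH (vertex_edge va)).
exact: H.
Qed.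

End Rigid.

Lemma pe_id n S a : is_edge S a -> pe (premap_of (ra_id (rooted n S))) a = Edge a.
Proof. by move=> ea; rewrite (@pe_ofE _ _ _ _ _ a ea). Qed.

Lemma pa_id n S i : i <= n -> pa (premap_of (ra_id (rooted n S))) i = inl i.
Proof. by move=> lei; rewrite (@pa_ofE _ _ _ _ _ i lei). Qed.

Lemma is_identity_id (X : do_obj) (F : do_hom X X) :
  (forall i, i <= X.1 -> pa (premap_of F) i = inl i) ->
  (forall a, is_edge X.2 a -> pe (premap_of F) a = Edge a) ->
  F = idc (c := do_cat) X.
Proof.
move=> Ha Hb; apply: ra_map_ext_gen => [i lei|a ea].
  by rewrite Ha // pa_id.
by rewrite Hb // pe_id.
Qed.

(** Equality of degrees forces both the numbers of stages and the numbers of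
    generators to agree, as neither can drop.  For the empty tree S the rigidity
    argument has no root to start from; then R has no generator, so R is empty
    or [n = 0] and R has a single edge. *)
Lemma plus_dichotomy (X Y : Ob do_cat) (F : Hom X Y) : do_plus F ->
  [\/ degree X < degree Y, is_identity F | X = (0, None) /\ Y = (0, Some PLeaf)].
Proof.
case: X Y F => n S [m R] F /do_plusP[/= Ha Hb]; have ok := premap_of_ok F.
have le1 := plus_stages_le ok Ha; have le2 := plus_gens_le ok Ha Hb.
have [lt|] := ltnP (degree (n, S)) (degree (m, R)); first by constructor 1.
rewrite /degree /= => ge.
have en : n = m.
  apply/eqP; rewrite eqn_leq le1 -(leq_add2r #|{: gen n S}|) (leq_trans _ ge) //.
  by rewrite leq_add2l.
subst m; rewrite leq_add2l in ge; clear le1; have onto := plus_gens_onto ok Ha Hb ge.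
case: S F ok Ha Hb le2 ge onto => [T|] F ok Ha Hb _ _ onto.
  have eR : Some T = R by apply: (rigid_tree ok Ha Hb onto).
  subst R; constructor 2.
  rewrite (is_identity_id (F := F)) //=.
    exact/(rigid_pa ok Ha)/(rigid_pa0 ok Ha onto).
  exact: (rigid_edge ok Ha Hb onto).
case: R F ok Ha Hb onto => [T|] F ok Ha Hb onto.
  have noR g : is_gen (Some T) n g = false.
    by apply/negP=> /onto[g']; rewrite no_gen.
  case: T F ok Ha Hb onto noR => [|ts] F ok Ha Hb onto noR; last first.
    by have := noR (Vert [::]).
  case: n F Ha ok Hb onto noR => [|n] F Ha ok Hb onto noR; first by constructor 3.
  by have := noR (Adj 0 (Id (Edge [::]))).
constructor 2; rewrite (is_identity_id (F := F)) //=.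
apply: (rigid_pa ok Ha).
by have := pa_obj ok (leq0n n); case: (pa _ 0) => [j|b] //; exists j.
Qed.

(** * Inverse maps have sections *)

Section Splitting.
Variables (n : nat) (S : otree) (m : nat) (R : otree) (p : premap).
Hypothesis ok : premap_ok n S m R p.
Hypothesis surj_pa : forall j, j <= m -> exists2 i, i <= n & pa p i = inl j.
Hypothesis surj_pe : forall b, is_edge R b -> exists2 a, is_edge S a & pe p a = Edge b.
Hypothesis leaves : forall a, is_leaf S a -> exists2 b, is_leaf R b & pe p a = Edge b.

Lemma split_pa0 : pa p 0 = inl 0.
Proof.
have [i lei ei] := surj_pa (leq0n m); have := pa_le ok (leq0n i) lei.
by rewrite ei; case: (pa p 0) => //= j; rewrite leqn0 => /eqP->.
Qed.

Definition first_stage (j : nat) : nat := index (inl j) (mkseq (pa p) n.+1).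

Lemma first_stageP j : j <= m -> first_stage j <= n /\ pa p (first_stage j) = inl j.
Proof.
move=> lej; have [i lei ei] := surj_pa lej.
have mj : inl j \in mkseq (pa p) n.+1.
  by apply/mapP; exists i; rewrite ?mem_iota.
have lt : first_stage j < n.+1 by move: mj; rewrite -index_mem size_mkseq.
by split=> //; rewrite -(nth_mkseq (inl 0) (pa p) lt) nth_index.
Qed.

Lemma first_stage0 : first_stage 0 = 0.
Proof. by rewrite /first_stage /mkseq /= split_pa0 eqxx. Qed.

(** If the order were reversed, monotonicity would put both stages over the same
    stage. *)
Lemma first_stage_le i j : i <= j -> j <= m -> first_stage i <= first_stage j.
Proof.
move=> leij lej; have [li ei] := first_stageP (leq_trans leij lej).
have [lj ej] := first_stageP lej; rewrite leqNgt; apply/negP => lt.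
have := pa_le ok (ltnW lt) li; rewrite ei ej /= => leji.
have e : i = j by apply/eqP; rewrite eqn_leq leij.
by rewrite e ltnn in lt.
Qed.

(** Edges with the same image are comparable, so the shortest prefix of any edge
    over [b] that lies over [b] is a prefix of all of them. *)
Lemma fibre_least b : exists a, is_edge R b ->
  [/\ is_edge S a, pe p a = Edge b
    & forall a', is_edge S a' -> pe p a' = Edge b -> prefix a a'].
Proof.
have [/surj_pe[a ea pa_b]|] := boolP (is_edge R b); last by exists [::].
have ex : exists k, pe p (take k a) == Edge b.
  by exists (size a); rewrite take_size pa_b.
have [k /eqP ek mk] := ex_minnP ex.
have et : is_edge S (take k a) by apply: edge_prefix ea; exact: prefix_take.
exists (take k a) => _; split=> // a' ea' pa'.
have := pe_comparable ok et ea'; rewrite ek pa' reaches_refl => /(_ isT)/orP[//|].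
move=> pre; have le' : size a' <= k.
  by rewrite (leq_trans (size_prefix pre)) ?size_take_min ?geq_minl.
have e : take (size a') a = a' by move: pre; rewrite prefixE take_takel // => /eqP.
have := mk (size a'); rewrite e pa' eqxx => /(_ isT) le.
have -> : k = size a' by apply/eqP; rewrite eqn_leq le.
by rewrite e prefix_refl.
Qed.

(** Starting from any edge over [b], go up through unary vertices sent to the
    identity of [b].  The climb ends at a vertex sent to the corolla of [b]: it
    cannot end at a leaf, leaves being sent to leaves.  The inputs of the last
    vertex are the least edges over the inputs of [b], because the edge below
    them lies over [b]. *)
Lemma split_op (s : seq nat -> seq nat) :
  (forall b, is_edge R b -> [/\ is_edge S (s b), pe p (s b) = Edge b
    & forall a', is_edge S a' -> pe p a' = Edge b -> prefix (s b) a']) ->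
  forall b a, is_vertex R b -> is_edge S a -> pe p a = Edge b ->
  exists u, [/\ is_op S n u, rtgt u = Edge a
    & rsrc u = [seq Edge (s (rcons b i)) | i <- iota 0 (arity R b)]].
Proof.
move=> Hs b a vb; rewrite /is_edge; case Sa : (subtree_at S a) => [T|] // _.
elim/ptree_ind_onth: T a Sa => [|ts IH] a Sa eab.
  have [|b' lb'] := @leaves a; first by rewrite /is_leaf Sa.
  rewrite eab => -[e]; move: vb lb'; rewrite -e /is_vertex /is_leaf.
  by case: (subtree_at R b) => [[]|].
have va : is_vertex S a by rewrite /is_vertex Sa.
have hit b' : is_vertex R b' -> exists2 e, is_edge S e & pe p e = Edge b'.
  by move/vertex_edge/surj_pe.
have [o t src] := pv_op ok va.
have [e|[_ e]] := pv_corolla ok hit va eab; rewrite e ?rsrc_gen_op /= in src.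
  case Ea : (arity S a) src => [|[|]] //= -[e0].
  have : is_edge S (rcons a 0) by rewrite edge_rcons va Ea.
  rewrite /is_edge; case Sa0 : (subtree_at S (rcons a 0)) => [T|] // _.
  have T0 : onth ts 0 = Some T by move: Sa0; rewrite subtree_rcons Sa.
  have [u [ou tu su]] := IH 0 T T0 (rcons a 0) Sa0 (esym e0).
  exists (Node (Vert a) [:: u]); split=> //=; last by rewrite cats0.
  by rewrite va ou tu Ea /= eqxx.
exists (gen_op S (Vert a)); split=> //; first exact: (@gen_op_op S n (Vert a)).
rewrite rsrc_gen_op /=.
have ar : arity S a = arity R b.
  by have := congr1 size src; rewrite !size_map !size_iota.
rewrite ar; apply/eq_in_map => i; rewrite mem_iota => lti; congr Edge.
have ebi : is_edge R (rcons b i) by rewrite edge_rcons vb.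
have eai : is_edge S (rcons a i) by rewrite edge_rcons va ar.
have pai : pe p (rcons a i) = Edge (rcons b i).
  have := congr1 (fun s => nth (Edge [::]) s i) src.
  by rewrite /= !(nth_map 0) ?size_iota ?ar // nth_iota.
have [es pes least] := Hs _ ebi.
have [->//|pre] := prefix_rcons_eq (least _ eai pai).
have := pe_reaches ok pre (vertex_edge va); rewrite pes eab reaches_Edge.
by rewrite prefix_rconsN.
Qed.

Lemma split_premap : exists q, [/\ premap_ok m R n S q,
   forall j, j <= m -> eobj p (pa q j) = inl j
 & forall b, is_edge R b -> ecol p (pe q b) = Edge b].
Proof.
have [s Hs] := choice fibre_least.
have Hu b : exists u, is_vertex R b -> [/\ is_op S n u, rtgt u = Edge (s b)
    & rsrc u = [seq Edge (s (rcons b i)) | i <- iota 0 (arity R b)]].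
  have [vb|] := boolP (is_vertex R b); last by exists (Id (Edge [::])).
  have [es pes _] := Hs b (vertex_edge vb).
  by have [u Hu] := split_op Hs vb es pes; exists u.
have [u {}Hu] := choice Hu.
exists (PreMap (fun b => Edge (s b)) u (fun j => inl (first_stage j))); split.
- split=> /=.
  + by move=> b /Hs[].
  + by move=> b /Hu.
  + by move=> j /first_stageP[].
  + exact: first_stage_le.
  + move=> e0; have [es pes least] := Hs _ e0; rewrite first_stage0.
    have eS0 := edge_prefix (prefix0s (s [::])) es.
    have r0 : pe p [::] = Edge [::].
      by apply: rcol_mu_Edge0; rewrite (pe_root ok) // split_pa0.
    by have := least _ eS0 r0; rewrite prefixs0 => /eqP->.
- by move=> j /first_stageP[].
- by move=> b /Hs[].
Qed.

End Splitting.

Lemma split_map n S m R (E : ra_map (rooted n S) (rooted m R)) :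
  (forall j, j <= m -> exists2 i, i <= n & pa (premap_of E) i = inl j) ->
  (forall b, is_edge R b -> exists2 a, is_edge S a & pe (premap_of E) a = Edge b) ->
  (forall a, is_leaf S a -> exists2 b, is_leaf R b & pe (premap_of E) a = Edge b) ->
  exists s, ra_comp E s = ra_id (rooted m R).
Proof.
move=> H1 H2 H3; have [q [okq Ha Hb]] := split_premap (premap_of_ok E) H1 H2 H3.
exists (mk_map okq); apply: ra_map_ext_gen => [j lej|b eb].
  by rewrite pa_comp // pa_mk // pa_id // Ha.
by rewrite pe_comp // pe_mk // pe_id // Hb.
Qed.

(** Surjectivity on colors gives surjectivity on edges: an adjoined color that
    goes to an edge has a stage as moment, so the edge is the root, which is
    also the image of the root. *)
Lemma minus_split (X Y : do_obj) (E : do_hom X Y) :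
  do_minus E -> exists s : do_hom Y X, ra_comp E s = ra_id (rooted Y.1 Y.2).
Proof.
case/do_minusP=> H1 H2 H3; apply: split_map => // b eb.
have ok := premap_of_ok E.
have [[a ea e|k h cc e]] := H2 (Edge b) eb; first by exists a.
have /and3P[ltk _ _] := cc.
have mu1 := ecol_mu ok cc; rewrite e -[RHS]/(pa (premap_of E) k.+1) in mu1.
have := pa_le ok (leq0n k.+1) ltk; rewrite -mu1 (split_pa0 ok H1).
case: b eb e mu1 => // eb e mu1 _.
have eS : is_edge X.2 [::].
  case: (X.2) cc => // cc; have := no_gen X.1 (Adj k h).
  by rewrite -[is_gen _ _ _]/(is_col None X.1 (New k h)) cc.
exists [::] => //; apply: rcol_mu_Edge0.
by rewrite (pe_root ok) // (split_pa0 ok H1).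
Qed.

(** * Existence of factorizations *)

Section Contraction.
Variable col : pred (seq nat).

(** [contract T a] contracts the subtree [T] placed at the edge [a], removing each
    vertex that satisfies [col].  Such a vertex is meant to be unary, hence
    [head]. *)
Fixpoint contract (T : ptree) (a : seq nat) : ptree :=
  match T with
  | PLeaf => PLeaf
  | PVertex ts =>
      let us := mkseq (fun i => nth (fun=> PLeaf) (map contract ts) i (rcons a i))
                      (size ts) in
      if col a then head PLeaf us else PVertex us
  end.

(** [squash] maps the path of an edge to its path in the contracted tree: it drops
    the steps through removed vertices.  Whether a step is dropped depends on
    the path before it, so the recursion runs over the reversed path. *)
Fixpoint squash_rev (r : seq nat) : seq nat :=
  if r is i :: r' then
    if col (rev r') then squash_rev r' else rcons (squash_rev r') i
  else [::].

Definition squash (a : seq nat) : seq nat := squash_rev (rev a).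

Lemma squash_rcons a i :
  squash (rcons a i) = if col a then squash a else rcons (squash a) i.
Proof. by rewrite /squash rev_rcons /= revK. Qed.

Lemma squash_prefix a b : prefix a b -> prefix (squash a) (squash b).
Proof.
case/prefixP=> w ->; elim/last_ind: w => [|w i IH]; first by rewrite cats0 prefix_refl.
rewrite -rcons_cat squash_rcons; case: ifP => // _.
exact: prefix_trans IH (prefix_rcons _ _).
Qed.

Variable S : otree.
Hypothesis col1 : forall a, is_vertex S a -> col a -> arity S a = 1.

Definition contraction : otree := omap (contract^~ [::]) S.

Lemma contract_vertex ts a i T : onth ts i = Some T ->
  nth (fun=> PLeaf) (map contract ts) i (rcons a i) = contract T (rcons a i).
Proof.
move=> ti; have lti : i < size ts by rewrite -onthTE ti.
by rewrite (nth_map PLeaf) // (onth_nth _ _ _ _ ti).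
Qed.

Lemma subtree_squash a T : subtree_at S a = Some T ->
  subtree_at contraction (squash a) = Some (contract T a).
Proof.
elim/last_ind: a T => [|a i IH] T.
  by rewrite /contraction /squash /= /subtree_at; case: S => //= U [->].
rewrite subtree_rcons squash_rcons.
case Sa : (subtree_at S a) => [[|ts]|] // Ti.
have := IH _ Sa; rewrite /=; case: ifP => ca.
  have := col1 (_ : is_vertex S a) ca; rewrite /is_vertex /arity Sa => /(_ isT).
  by case: ts Ti {Sa} => [|U [|]] //; case: i => [|[]] //= [->] _.
rewrite subtree_rcons => ->; have lti : i < size ts by rewrite -onthTE Ti.
rewrite /mkseq onth_map onthE (nth_map 0) ?size_iota // nth_iota //=.
by rewrite add0n (contract_vertex a Ti).
Qed.

Lemma squash_edge a : is_edge S a -> is_edge contraction (squash a).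
Proof.
rewrite /is_edge; case Sa : (subtree_at S a) => [T|] //.
by rewrite (subtree_squash Sa).
Qed.

Lemma squash_leaf a : is_leaf S a -> is_leaf contraction (squash a).
Proof.
rewrite /is_leaf; case Sa : (subtree_at S a) => [[|]|] //.
by rewrite (subtree_squash Sa).
Qed.

Lemma squash_vertex a : is_vertex S a -> ~~ col a ->
  is_vertex contraction (squash a) /\ arity contraction (squash a) = arity S a.
Proof.
rewrite /is_vertex /arity; case Sa : (subtree_at S a) => [[|ts]|] // _ nca.
by rewrite (subtree_squash Sa) /= (negPf nca) size_mkseq.
Qed.

Lemma squash_vertexI a :
  is_edge S a -> is_vertex contraction (squash a) -> is_vertex S a.
Proof.
rewrite /is_edge /is_vertex; case Sa : (subtree_at S a) => [[|ts]|] // _.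
by rewrite (subtree_squash Sa).
Qed.

Lemma squash_top a : is_edge S a -> exists a', [/\ is_edge S a',
  squash a' = squash a & is_vertex S a' -> ~~ col a'].
Proof.
rewrite /is_edge; case Sa : (subtree_at S a) => [T|] // _.
elim/ptree_ind_onth: T a Sa => [|ts IH] a Sa.
  by exists a; rewrite /is_edge /is_vertex Sa.
have [ca|nca] := boolP (col a); last by exists a; rewrite /is_edge Sa.
have va : is_vertex S a by rewrite /is_vertex Sa.
have := col1 va ca; rewrite /arity Sa => sz.
have : onth ts 0 by rewrite onthTE sz.
case T0 : (onth ts 0) => [T|] // _.
have [|a' [ea' qa' ta']] := IH 0 T T0 (rcons a 0); first by rewrite subtree_rcons Sa.
by exists a'; split=> //; rewrite qa' squash_rcons ca.
Qed.

(** The edge found lies at the top of its fibre, so that the vertex of which it is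
    the output survives in the contraction. *)
Lemma squash_onto b : exists a, is_edge contraction b ->
  [/\ is_edge S a, squash a = b & is_vertex S a -> ~~ col a].
Proof.
have [|] := boolP (is_edge contraction b); last by exists [::].
move=> eb; suff [a Ha] : exists a,
    [/\ is_edge S a, squash a = b & is_vertex S a -> ~~ col a] by exists a.
elim/last_ind: b eb => [|b i IH].
  have [eS _|] := boolP (is_edge S [::]).
    by have [a [ea qa ta]] := squash_top eS; exists a.
  by rewrite /is_edge /contraction; case: (S).
rewrite edge_rcons => /andP[vb lti].
have [a [ea qa ta]] := IH (vertex_edge vb).
have va : is_vertex S a by apply: squash_vertexI ea _; rewrite qa.
have [_ ar] := squash_vertex va (ta va); rewrite qa in ar; rewrite ar in lti.
have eai : is_edge S (rcons a i) by rewrite edge_rcons va.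
have [a' [ea' qa' ta']] := squash_top eai; exists a'; split=> //.
by rewrite qa' squash_rcons (negPf (ta va)) qa.
Qed.

(** Incomparable edges separate at a vertex with several inputs, which is not
    removed, so their paths stay separate. *)
Lemma squash_eq a a' : is_edge S a -> is_edge S a' -> squash a = squash a' ->
  prefix a a' || prefix a' a.
Proof.
move=> ea ea' e; apply/negPn; rewrite negb_or; apply/negP => /andP[n1 n2].
have [c [i [j [nij ci cj]]]] := incomparable_split n1 n2.
have := edge_prefix ci ea; have := edge_prefix cj ea'.
rewrite !edge_rcons => /andP[vc ltj] /andP[_ lti].
have nc : col c = false.
  apply/negP => /(col1 vc) ar; rewrite ar !ltnS !leqn0 in lti ltj.
  by rewrite (eqP lti) (eqP ltj) in nij.
have := squash_prefix ci; have := squash_prefix cj.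
rewrite !squash_rcons nc e => pj pi.
have := prefix_comparable pi pj.
by rewrite -!cats1 !prefix_catr // !eqxx /= !andbT [j == i]eq_sym orbb (negPf nij).
Qed.

Lemma squash_chain (A : Type) (f : seq nat -> A) :
  (forall a, is_vertex S a -> col a -> f (rcons a 0) = f a) ->
  forall a a', is_edge S a -> is_edge S a' -> squash a = squash a' -> f a = f a'.
Proof.
move=> Hf; suff H a w :
    is_edge S (a ++ w) -> squash a = squash (a ++ w) -> f a = f (a ++ w).
  move=> a a' ea ea' e; case/orP: (squash_eq ea ea' e) => /prefixP[w ew].
    by move: ea' e; rewrite ew; exact: H.
  by move: ea e; rewrite ew => ea e; apply/esym/H.
elim/last_ind: w => [|w i IH]; first by rewrite cats0.
rewrite -rcons_cat edge_rcons squash_rcons => /andP[vw lti].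
case: ifP => cw e; last first.
  have := squash_prefix (prefix_prefix a w); rewrite e => /size_prefix.
  by rewrite size_rcons ltnn.
rewrite (IH (vertex_edge vw) e); move: lti; rewrite (col1 vw cw) ltnS leqn0 => /eqP->.
by rewrite Hf.
Qed.

End Contraction.

Section Steps.
Variables (x : nat -> robj) (n : nat).
Hypothesis x_le : forall i j, i <= j -> j <= n -> robj_le (x i) (x j).

(** The position of [x i] among the distinct values of the monotone sequence [x]:
    this is the surjective part of the factorization of [x]. *)
Fixpoint steps (i : nat) : nat :=
  if i is j.+1 then steps j + (x j != x j.+1) else 0.

Lemma steps_mono i j : i <= j -> steps i <= steps j.
Proof.
move=> /subnKC <-; elim: (j - i) => [|d IH]; first by rewrite addn0.
by rewrite addnS /= (leq_trans IH) ?leq_addr.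
Qed.

Lemma steps_eq i j : i <= n -> j <= n -> (steps i = steps j) <-> (x i = x j).
Proof.
wlog leij : i j / i <= j.
  move=> H lei lej; case/orP: (leq_total i j) => le; first exact: H.
  by split=> /esym/H H'; apply/esym/H'.
move=> _; move: leij => /subnKC <-.
elim: (j - i) => [|d IH] lej; first by rewrite addn0.
rewrite addnS in lej *; have [IH1 IH2] := IH (ltnW lej).
have le1 := steps_mono (leq_addr d i).
split=> [/=|e].
  case: eqP => [<-|_] /=; first by rewrite addn0.
  by move=> e; move: le1; rewrite e addn1 ltnn.
have e1 : x i = x (i + d).
  apply: robj_le_anti; first by apply: x_le; rewrite ?leq_addr // ltnW.
  by rewrite e; apply: x_le.
by rewrite /= (IH2 e1) -e1 e eqxx addn0.
Qed.

Lemma steps_onto k : k <= steps n -> exists2 i, i <= n & steps i = k.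
Proof.
elim: n => [|j IH]; first by rewrite leqn0 => /eqP->; exists 0.
rewrite /= => lek; have [/IH[i lei ei]|lt] := leqP k (steps j).
  by exists i => //; exact: leqW.
exists j.+1 => //=; apply/eqP; rewrite eqn_leq lek andbT.
by rewrite (leq_trans _ lt) // addnC; case: eqP.
Qed.

End Steps.

Section Factorization.
Variables (n : nat) (S : otree) (m : nat) (R : otree).
Variable F : ra_map (rooted n S) (rooted m R).
Let p := premap_of F.
Let ok : premap_ok n S m R p := premap_of_ok F.
Let col : pred (seq nat) := fun a => pv p a == Id (pe p a).
Let q := squash col.
Let T := contraction col S.
Let st := steps (pa p).

Lemma col_arity a : is_vertex S a -> col a -> arity S a = 1.
Proof.
move=> va /eqP ca; have [_ _] := pv_op ok va; rewrite ca /=.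
by move/(congr1 size); rewrite size_map size_iota.
Qed.

Lemma col_child a : is_vertex S a -> col a -> pe p (rcons a 0) = pe p a.
Proof.
move=> va ca; have [_ _] := pv_op ok va; rewrite (col_arity va ca) (eqP ca) /=.
by case.
Qed.

Lemma squash_pe a a' : is_edge S a -> is_edge S a' -> q a = q a' -> pe p a = pe p a'.
Proof. exact: (squash_chain col_arity col_child). Qed.

(** Edges with equal images are comparable, and all edges between them have the
    same image, so the vertices between them go to identities. *)
Lemma pe_squash a a' : is_edge S a -> is_edge S a' -> pe p a = pe p a' -> q a = q a'.
Proof.
suff H c w : is_edge S (c ++ w) -> pe p c = pe p (c ++ w) -> q c = q (c ++ w).
  move=> ea ea' e; have := pe_comparable ok ea ea'; rewrite e reaches_refl => /(_ isT).
  case/orP=> /prefixP[w ew]; first by move: ea' e; rewrite ew; exact: H.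
  by move: ea e; rewrite ew => ea e; apply/esym/H.
elim/last_ind: w => [|w i IH]; first by rewrite cats0.
rewrite -rcons_cat => ei e; have := ei; rewrite edge_rcons => /andP[vw lti].
have e1 : pe p c = pe p (c ++ w).
  apply: reaches_anti.
    exact: (pe_reaches ok (prefix_prefix _ _) (vertex_edge vw)).
  by rewrite e; apply: (pe_reaches ok (prefix_rcons _ _) ei).
have cw : col (c ++ w).
  by apply/eqP/(pv_Id ok vw); rewrite -e1 e; apply: (pe_src ok).
by rewrite /q squash_rcons cw; apply: IH => //; exact: vertex_edge.
Qed.

Definition quotient_premap : premap :=
  PreMap (fun a => Edge (q a))
    (fun a => if col a then Id (Edge (q a)) else gen_op T (Vert (q a)))
    (fun i => inl (st i)).

Lemma quotient_ok : premap_ok n S (st n) T quotient_premap.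
Proof.
split=> /=.
- by move=> a; apply: (squash_edge col_arity).
- move=> a va; case: ifPn => ca.
    have ar := col_arity va ca; split=> //=.
      exact/(squash_edge col_arity)/vertex_edge.
    by rewrite ar /= /q squash_rcons ca.
  have [vq ar] := squash_vertex col_arity va ca.
  split=> //; first exact: (@gen_op_op T _ (Vert (q a))).
  rewrite rsrc_gen_op /= ar; apply: eq_map => i.
  by rewrite /q squash_rcons (negPf ca).
- by move=> i lei; apply: steps_mono.
- by move=> i j leij _; apply: steps_mono.
- by [].
Qed.

(** The second map is given by the values of [F] at arbitrary representatives: a
    stage [d k] over [k] and the top edge [s b] over [b]. *)
Lemma factorization : exists (Z : do_obj) (E : do_hom (n, S) Z) (G : do_hom Z (m, R)),
  [/\ do_minus E, do_plus G & ra_comp G E = F].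
Proof.
have [s Hs] := choice (squash_onto col_arity).
have Hd k : exists i, k <= st n -> i <= n /\ st i = k.
  have [/steps_onto[i]|] := leqP k (st n); last by exists 0.
  by exists i.
have [d {}Hd] := choice Hd.
have pes a b : is_edge S a -> is_edge T b -> q a = b -> pe p (s b) = pe p a.
  by move=> ea eb e; have [es qs _] := Hs b eb; apply: squash_pe => //; rewrite /q qs.
pose g := PreMap (fun b => pe p (s b)) (fun b => pv p (s b)) (fun k => pa p (d k)).
have okg : premap_ok (st n) T m R g.
  split=> /=.
  - by move=> b eb; have [es _ _] := Hs b eb; apply: (pe_col ok).
  - move=> b vb; have eb := vertex_edge vb; have [es qs ts] := Hs b eb.
    have vs : is_vertex S (s b) by apply: (squash_vertexI col_arity es); rewrite qs.
    have [o t src] := pv_op ok vs; split=> //; rewrite src.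
    have [_ ar] := squash_vertex col_arity vs (ts vs); rewrite qs in ar; rewrite -ar.
    apply/eq_in_map => i; rewrite mem_iota => lti; apply/esym.
    apply: pes; first by rewrite edge_rcons vs -ar.
      by rewrite edge_rcons vb.
    by rewrite /q squash_rcons (negPf (ts vs)) qs.
  - by move=> k /Hd[led _]; apply: (pa_obj ok).
  - move=> i j leij lej; have [li ei] := Hd _ (leq_trans leij lej).
    have [lj ej] := Hd _ lej.
    case/orP: (leq_total (d i) (d j)) => le; first exact: (pa_le ok).
    suff e : pa p (d i) = pa p (d j).
      by have := robj_le_refl (pa p (d i)); rewrite {2}e.
    apply/(steps_eq (pa_le ok) li lj); rewrite -/st ei ej.
    have := steps_mono (pa p) le; rewrite -/st ei ej => leji.
    by apply/eqP; rewrite eqn_leq leij.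
  - move=> e0; have eS : is_edge S [::].
      by have [es _ _] := Hs _ e0; apply: edge_prefix es; exact: prefix0s.
    rewrite -[LHS]/(rcol_mu (pe p (s [::]))) -[RHS]/(pa p (d 0)).
    rewrite (pes [::] [::]) // (pe_root ok) //.
    have [l0 s0] := Hd 0 (leq0n _); apply/(steps_eq (pa_le ok)) => //.
(* [E] is surjective on colors because it has a section. *)
pose E : do_hom (n, S) (st n, T) := mk_map quotient_ok.
pose G : do_hom (st n, T) (m, R) := mk_map okg.
exists (st n, T), E, G; split.
- have [||| sec es] := @split_map n S (st n) T E.
  + by move=> j /Hd[led e]; exists (d j); rewrite ?pa_mk //= e.
  + by move=> b eb; have [es qs _] := Hs b eb; exists (s b); rewrite ?pe_mk //= /q qs.
  + move=> a la; exists (q a); first exact: (squash_leaf col_arity).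
    by rewrite pe_mk ?leaf_edge.
  apply/do_minusP; split=> [j|c cc|a la].
  + by move=> /Hd[led e]; exists (d j); rewrite ?pa_mk //= e.
  + pose c' : on_col (st n) T := Sub c cc.
    exists (val (fcol (mapd sec) c' : on_col n S)); first exact: valP.
    rewrite -val_fcol.
    pose ev (H : do_hom (st n, T) (st n, T)) : on_col (st n) T := fcol (mapd H) c'.
    exact: (congr1 val (congr1 ev es)).
  + exists (q a); first exact: (squash_leaf col_arity).
    by rewrite pe_mk ?leaf_edge.
- apply/do_plusP; split=> [i j lei lej|a b ea eb].
    rewrite !pa_mk //= => e; have [li ei] := Hd _ lei; have [lj ej] := Hd _ lej.
    by rewrite -ei -ej; apply/(steps_eq (pa_le ok) li lj).
  rewrite !pe_mk //= => e; have [sa qa _] := Hs _ ea; have [sb qb _] := Hs _ eb.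
  by rewrite -qa -qb; apply: pe_squash.
- apply: ra_map_ext_gen => [i lei|a ea].
    have le := steps_mono (pa p) lei.
    rewrite pa_comp // pa_mk // -[LHS]/(pa (premap_of G) (st i)) pa_mk //.
    rewrite -[LHS]/(pa p (d (st i))); have [l e] := Hd _ le.
    by apply/(steps_eq (pa_le ok)).
  have eq := squash_edge col_arity ea.
  rewrite pe_comp // pe_mk // -[LHS]/(pe (premap_of G) (q a)) pe_mk //.
  exact: pes.
Qed.

End Factorization.

(** * The Reedy structure *)

Lemma plus_comp X Y Z (G : do_hom Y Z) (F : do_hom X Y) :
  do_plus G -> do_plus F -> do_plus (ra_comp G F).
Proof.
move=> /do_plusP[Ga Gb] /do_plusP[Fa Fb].
have okG := premap_of_ok G; have okF := premap_of_ok F.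
apply/do_plusP; split=> [i j lei lej|a b ea eb].
  rewrite !pa_comp // => /(eobj_inj okG Ga Gb (pa_obj okF lei) (pa_obj okF lej)).
  exact: Fa.
rewrite !pe_comp // => /(ecol_inj okG Ga Gb (pe_col okF ea) (pe_col okF eb)).
exact: Fb.
Qed.

Lemma minus_comp X Y Z (G : do_hom Y Z) (F : do_hom X Y) :
  do_minus G -> do_minus F -> do_minus (ra_comp G F).
Proof.
move=> /do_minusP[G1 G2 G3] /do_minusP[F1 F2 F3].
apply/do_minusP; split=> [j lej|c cc|a la].
- have [i lei ei] := G1 j lej; have [k lek ek] := F1 i lei.
  by exists k => //; rewrite pa_comp // ek.
- have [c1 cc1 e1] := G2 c cc; have [c2 cc2 e2] := F2 c1 cc1.
  exists c2 => //; pose c2' : on_col X.1 X.2 := Sub c2 cc2.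
  rewrite -[LHS](val_fcol (ra_comp G F) c2').
  by rewrite -[LHS]/(val (fcol (mapd G) (fcol (mapd F) c2'))) !val_fcol e2.
have [b lb eb] := F3 a la; have [c lc ec] := G3 b lb; exists c => //.
by rewrite pe_comp ?eb ?leaf_edge.
Qed.

(** A section is injective on everything. *)
Lemma section_plus X Y (E : do_hom X Y) (s : do_hom Y X) :
  ra_comp E s = ra_id (rooted Y.1 Y.2) -> do_plus s.
Proof.
move=> Es; apply/do_plusP; split=> [i j lei lej e|a b ea eb e].
  suff [] : inl i = inl j :> robj by [].
  by rewrite -(pa_id Y.2 lei) -(pa_id Y.2 lej) -Es !pa_comp // e.
suff [] : Edge a = Edge b by [].
by rewrite -(pe_id Y.1 ea) -(pe_id Y.1 eb) -Es !pe_comp // e.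
Qed.

Lemma id_plus X : do_plus (ra_id (rooted X.1 X.2) : do_hom X X).
Proof. by apply: (@section_plus X X (ra_id _)); rewrite ra_comp1. Qed.

Lemma id_minus X : do_minus (ra_id (rooted X.1 X.2) : do_hom X X).
Proof.
apply/do_minusP; split=> [j lej|c cc|a la].
- by exists j; rewrite ?pa_id.
- exists c => //; exact: (esym (val_fcol (ra_id (rooted X.1 X.2)) (Sub c cc))).
- by exists a; rewrite ?pe_id ?leaf_edge.
Qed.

Lemma no_map_to_empty (F : do_hom (0, Some PLeaf) (0, None)) : False.
Proof.
pose r : on_col 0 (Some PLeaf) := exist _ (Edge [::]) isT.
exact: col0_rect (fcol (mapd F) r).
Qed.

Lemma section_identity (X Y : Ob do_cat) (s : Hom Y X) : is_identity s ->
  forall E : Hom X Y, compc E s = idc Y -> is_identity E.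
Proof. by case: X s / => E; rewrite compc1 => ->. Qed.

Lemma minus_lowers (X Y : Ob do_cat) (F : Hom X Y) :
  do_minus F -> ~ is_identity F -> degree Y < degree X.
Proof.
move=> mF nF; have [s Fs] := minus_split mF.
have [//|ids|[eY eX]] := plus_dichotomy (section_plus Fs).
  by case: nF; apply: section_identity ids _ Fs.
by subst X Y; case: (no_map_to_empty F).
Qed.

Lemma degree_empty : degree (0, None) = 0.
Proof.
by rewrite /degree add0n; apply: eq_card0 => -[g gg]; exfalso; rewrite no_gen in gg.
Qed.

Lemma shifted_degree_lt X Y :
  degree X < degree Y -> shifted_degree X < shifted_degree Y.
Proof.
have d0 := degree_empty; have E Z : Z = (0, None) \/ shifted_degree Z = (degree Z).+1.
  by case: Z => [[|k] [T|]]; [right|left|right|right].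
case: (E Y) => [->|->]; first by rewrite d0.
by case: (E X) => [->|->].
Qed.

Lemma plus_raises (X Y : Ob do_cat) (F : Hom X Y) :
  do_plus F -> ~ is_identity F -> shifted_degree X < shifted_degree Y.
Proof.
move=> pF nF; have [/shifted_degree_lt//|//|[-> ->]//] := plus_dichotomy pF.
Qed.

(** Both maps are sections, hence direct, and the degree cannot rise both ways. *)
Lemma retract_identity (Z Z' : Ob do_cat) (u : Hom Z Z') (w : Hom Z' Z) :
  compc w u = idc Z -> compc u w = idc Z' -> is_identity u.
Proof.
move=> wu uw; have [] := plus_dichotomy (section_plus wu).
- have [lt1 lt2|idw|[e1 e2]] := plus_dichotomy (section_plus uw).
  + by have := ltn_trans lt1 lt2; rewrite ltnn.
  + by move=> _; exact: section_identity idw _ uw.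
  + by subst Z Z'; case: (no_map_to_empty u).
- by [].
- by case=> e1 e2; subst Z Z'; case: (no_map_to_empty w).
Qed.

Lemma factor_transport (X Y Z Z' : Ob do_cat) (u : Hom Z Z')
    (E : Hom X Z) (G : Hom Z Y) (E' : Hom X Z') (G' : Hom Z' Y) :
  is_identity u -> do_plus G -> compc G' u = G -> compc G E = compc G' E' ->
  existT (fun z => (Hom X z * Hom z Y)%type) Z (E, G) = existT _ Z' (E', G').
Proof.
move=> idu; case: Z' u / idu E' G' => E' G' pG; rewrite compc1 => -> e.
by rewrite (plus_mono pG e).
Qed.

Lemma factor_unique (X Y Z Z' : Ob do_cat)
    (E : Hom X Z) (G : Hom Z Y) (E' : Hom X Z') (G' : Hom Z' Y) :
  do_minus E -> do_plus G -> do_minus E' -> do_plus G' -> compc G E = compc G' E' ->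
  existT (fun z => (Hom X z * Hom z Y)%type) Z (E, G) = existT _ Z' (E', G').
Proof.
move=> mE pG mE' pG' e.
have [s Es] : exists s, compc E s = idc Z by exact: minus_split mE.
have [s' Es'] : exists s, compc E' s = idc Z' by exact: minus_split mE'.
have G'u : compc G' (compc E' s) = G by rewrite compcA -e -compcA Es compc1.
have Gw : compc G (compc E s') = G' by rewrite compcA e -compcA Es' compc1.
apply: (factor_transport _ pG G'u e); apply: (@retract_identity _ _ _ (compc E s')).
  apply: (plus_mono pG); rewrite -[LHS]/(compc G (compc (compc E s') (compc E' s))).
  by rewrite -[RHS]/(compc G (idc Z)) compcA Gw G'u compc1.
apply: (plus_mono pG'); rewrite -[LHS]/(compc G' (compc (compc E' s) (compc E s'))).
by rewrite -[RHS]/(compc G' (idc Z')) compcA G'u Gw compc1.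
Qed.

Theorem theorem3p16 :
  [/\ is_reedy (C := do_cat) (@do_plus) (@do_minus) shifted_degree,
      forall (X Y : Ob do_cat) (F : Hom X Y),
        do_plus F -> ~ is_identity F ->
        ~ (X = (0, None) /\ Y = (0, Some PLeaf)) ->
        degree X < degree Y
    & forall (X Y : Ob do_cat) (F : Hom X Y),
        do_minus F -> ~ is_identity F -> degree Y < degree X].
Proof.
split; [|by move=> X Y F /plus_dichotomy[]|exact: minus_lowers].
split.
- by split; [exact: id_plus|exact: plus_comp].
- by split; [exact: id_minus|exact: minus_comp].
- exact: plus_raises.
- by move=> X Y F mF /(minus_lowers mF) /shifted_degree_lt.
move=> X Y F.
have [Z [E [G [mE pG GE]]]] : exists (Z : Ob do_cat) (E : Hom X Z) (G : Hom Z Y),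
    [/\ do_minus E, do_plus G & compc G E = F].
  by case: X Y F => n S [m R] F; exact: factorization F.
exists (existT _ Z (E, G)); split=> //= -[Z' [E' G']] [/= mE' pG' GE'].
by apply: factor_unique => //; exact: (etrans GE (esym GE')).
Qed.
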